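(* Let $0<\epsilon<1$ and $r>0$ be constants, and let $p_2=\frac{1-\epsilon}{n}$, $p_3=\frac{r}{n\ln n}$. Define $$I_{\epsilon,r}=\int_{0}^{\epsilon/r}\big[1-\lambda(\omega)+\ln \lambda(\omega)\big]\,d\omega=-\frac{1}{r}\Big[\epsilon-\frac{\epsilon^2}{2}+(1-\epsilon)\ln(1-\epsilon)\Big],\qquad \lambda(x)=1-\epsilon+rx.$$ Then, as $n\to\infty$: (i) if $I_{\epsilon,r}<-1$, then with high probability $\mathbb{G}(n,p_2,p_3)$ is not propagation connected; (ii) if $I_{\epsilon,r}>-1$, then with high probability $\mathbb{G}(n,p_2,p_3)$ is propagation connected.
   Context: $\mathbb{G}(n,p_2,p_3)$ is the random hypergraph on a vertex set $V$ with $|V|=n$ in which each of the $\binom n2$ possible 2-element edges is present with probability $p_2$ and each of the $\binom n3$ possible 3-element hyperedges is present with probability $p_3$, all independently. ''With high probability'' (w.h.p.) means with probability tending to $1$ as $n\to\infty$. A hypergraph $H=(V,E)$ on $n$ vertices whose edges have size 2 or 3 is propagation connected if there exist edges $e_1,e_2,\dots,e_{n-1}\in E$ such that for every $1\le l\le n-2$, $|e_{l+1}\cap\bigcup_{i=1}^{l}e_i|=|e_{l+1}|-1$ (i.e. each new edge contains exactly one vertex not covered by the previous edges). *)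

(* Defs.v *)
From Stdlib Require Import Reals.
From mathcomp Require Import all_boot.
Local Open Scope R_scope.
Set Implicit Arguments. Unset Strict Implicit. Unset Printing Implicit Defensive.

Definition sumR (T : finType) (P : pred T) (f : T -> R) : R :=
  foldr Rplus 0 (map f (filter P (enum T))).
Definition prodR (T : finType) (f : T -> R) : R :=
  foldr Rmult 1 (map f (enum T)).

(* A hypergraph on V = 'I_n is a set of edges H : {set {set 'I_n}}.
   Probability that G(n,p2,p3) equals H: each 2-set is an edge with prob p2,
   each 3-set with prob p3, independently; other edge sizes have prob 0. *)
Definition hg_weight (n : nat) (p2 p3 : R) (H : {set {set 'I_n}}) : R :=
  if [forall e in H, (#|e| == 2)%N || (#|e| == 3)%N] then
    prodR (fun e : {set 'I_n} =>
      if (#|e| == 2)%N then (if e \in H then p2 else (1 - p2))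
      else if (#|e| == 3)%N then (if e \in H then p3 else (1 - p3))
      else 1)
  else 0.

Definition hg_prob (n : nat) (p2 p3 : R) (P : pred {set {set 'I_n}}) : R :=
  sumR P (hg_weight p2 p3).

(* Propagation connectedness: edges e_1..e_{n-1} of H (here t_0..t_{n-2}) such that
   for every 1 <= l <= n-2, |e_{l+1} ∩ (e_1 ∪ ... ∪ e_l)| = |e_{l+1}| - 1. *)
Definition prop_connected (n : nat) (H : {set {set 'I_n}}) : bool :=
  [exists t : (n.-1).-tuple {set 'I_n},
     all (fun e => e \in H) t &&
     [forall l : 'I_n.-1, ((1 <= l)%N && (l <= n - 2)%N) ==>
        (#|tnth t l :&: \bigcup_(i < l) nth set0 t i| == #|tnth t l| - 1)%N]].

Definition p2_of (eps : R) (n : nat) : R := ((1 - eps) / INR n).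
Definition p3_of (r : R) (n : nat) : R := (r / (INR n * ln (INR n))).

(* Closed form of I_{eps,r} = int_0^{eps/r} [1 - lambda(w) + ln lambda(w)] dw. *)
Definition I_er (eps r : R) : R :=
  (- (1 / r) * (eps - eps ^ 2 / 2 + (1 - eps) * ln (1 - eps))).

(* Main.v *)
(* From a seed vertex, infected vertices are processed one at a time: processing
   the j-th vertex x infects each untouched w with the edge {x,w} or an edge
   {x,y,w}, y processed earlier.  Each such edge is examined once, so the number
   of new infections is binomial with mean close to lambda(j / ln n).  A seed
   survives (eps / r) ln n steps, up to the point where lambda = 1, with
   probability n^(I + o(1)).

   Upper bound on survival: C_j lambda_j^(-a), a the number of active vertices,
   is a supersolution of the recursion, by the tilting which makes every step
   critical.  If I < -1 a union bound over the n seeds concludes.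

   Lower bound: multiplying this by a parabola a (M - a) gives a subsolution,
   which past criticality is continued by 1 - Lambda^(-a).  If I > -1, about
   n^(1 - gamma/4) successive trials, each avoiding the vertices processed before,
   thus produce a seed infecting a multiple of (ln n)^2 vertices w.h.p.  A first
   moment bound over vertex sets shows that w.h.p. no proper set of at least that
   size is closed under propagation, so that this seed infects everything. *)

From HB Require Import structures.
Require Import Defs.
From Stdlib Require Import Reals Lra.
From mathcomp Require Import all_boot zify.

Local Open Scope R_scope.
Set Implicit Arguments.
Unset Strict Implicit.
Unset Printing Implicit Defensive.

(** * Finite product measures *)

(** A subsolution must be at most 0 when no vertex is active, which C_j lambda_j^(-a) is not. Under
    the tilting the number of active vertices becomes a critical walk killed at 0, so the correction
    has to be a function of a that vanishes at 0 and is nearly invariant for that walk. On a strip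
    of constant width M the parabola loses a factor 1 - O(1/M) per step, hence n^(-O(1/M)) over O(ln
    n) steps. The gap between I and -1 absorbs this once M is a large constant.

    Conditional probabilities are avoided altogether: once Z is burnt, the rest of the process reads
    only edges with at least two vertices outside Z, and none of these has been read before. Each
    step thus becomes an exact finite recursion over coin tosses. Two choices make the law of a step
    depend only on the number j of vertices processed in the current trial: third vertices are taken
    from that trial only, and the lower bound examines a fixed number of candidates. *)

HB.instance Definition _ := Monoid.isComLaw.Build R 0 Rplus
  (fun x y z => esym (Rplus_assoc x y z)) Rplus_comm Rplus_0_l.
HB.instance Definition _ := Monoid.isComLaw.Build R 1 Rmult
  (fun x y z => esym (Rmult_assoc x y z)) Rmult_comm Rmult_1_l.
HB.instance Definition _ := Monoid.isMulLaw.Build R 0 Rmult Rmult_0_l Rmult_0_r.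
HB.instance Definition _ := Monoid.isAddLaw.Build R Rmult Rplus
  Rmult_plus_distr_r Rmult_plus_distr_l.

Notation "\rsum_ ( i | P ) F" := (\big[Rplus/0]_(i | P%B) F)
  (at level 41, F at level 41, i at level 50).
Notation "\rsum_ ( i : t | P ) F" := (\big[Rplus/0]_(i : t | P%B) F)
  (at level 41, F at level 41, i at level 50, only parsing).
Notation "\rsum_ i F" := (\big[Rplus/0]_i F) (at level 41, F at level 41, i at level 0).
Notation "\rprod_ ( i | P ) F" := (\big[Rmult/1]_(i | P%B) F)
  (at level 36, F at level 36, i at level 50).
Notation "\rprod_ i F" := (\big[Rmult/1]_i F) (at level 36, F at level 36, i at level 0).

Lemma rsum_ge0 (I : finType) (P : pred I) (F : I -> R) :
  (forall i, P i -> 0 <= F i) -> 0 <= \rsum_(i | P i) F i.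
Proof. by move=> h; apply: big_ind => // *; lra. Qed.

Lemma rsum_le (I : finType) (P : pred I) (F G : I -> R) :
  (forall i, P i -> F i <= G i) -> \rsum_(i | P i) F i <= \rsum_(i | P i) G i.
Proof. by move=> h; apply: (big_ind2 (fun x y => x <= y)) => // *; lra. Qed.

Lemma rsum_sub (I : finType) (P Q : pred I) (F : I -> R) :
  (forall i, 0 <= F i) -> (forall i, P i -> Q i) ->
  \rsum_(i | P i) F i <= \rsum_(i | Q i) F i.
Proof.
move=> F0 PQ; rewrite (bigID P Q) /=.
have -> : \rsum_(i | Q i && P i) F i = \rsum_(i | P i) F i.
  by apply: eq_bigl => i; case: (boolP (P i)) => [/PQ->|]; rewrite ?andbF.
by have := @rsum_ge0 I (fun i => Q i && ~~ P i) F (fun i _ => F0 i); lra.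
Qed.

Lemma rprod_pow (I : finType) (P : pred I) (x : R) :
  \rprod_(i | P i) x = x ^ #|P|.
Proof. by rewrite big_const; elim: #|P| => //= k ->. Qed.

Lemma rprod_ge0 (I : finType) (P : pred I) (F : I -> R) :
  (forall i, 0 <= F i) -> 0 <= \rprod_(i | P i) F i.
Proof. by move=> h; apply: big_ind => // *; [lra | apply: Rmult_le_pos]. Qed.

Section ProductMeasure.
Variables (T : finType) (p : T -> R).
Implicit Types (H Q : {set T}) (A B : pred {set T}).

Definition wt H : R := \rprod_e (if e \in H then p e else 1 - p e).
Definition Pr A : R := \rsum_(H | A H) wt H.

Definition determined (Q : pred T) A :=
  forall H H', (forall e, Q e -> (e \in H) = (e \in H')) -> A H = A H'.

Lemma Pr_total : Pr predT = 1.
Proof.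
rewrite /Pr /wt -bigA_distr big1 // => e _ /=; lra.
Qed.

Lemma eq_Pr A B : A =1 B -> Pr A = Pr B.
Proof. by move=> AB; apply: eq_bigl. Qed.

Lemma Pr_split A B : Pr A = Pr (fun H => B H && A H) + Pr (fun H => ~~ B H && A H).
Proof.
rewrite /Pr (bigID B) /=; congr (_ + _); apply: eq_bigl => H; exact: andbC.
Qed.

Lemma Pr_compl A : Pr (fun H => ~~ A H) = 1 - Pr A.
Proof.
rewrite -Pr_total (Pr_split predT A).
rewrite (eq_Pr (A := fun H => A H && _) (B := A)); last by move=> H; rewrite andbT.
rewrite (eq_Pr (A := fun H => ~~ A H && _) (B := fun H => ~~ A H)); first by lra.
by move=> H; rewrite andbT.
Qed.

Lemma Pr_pred0 : Pr pred0 = 0.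
Proof. exact: big_pred0_eq. Qed.

(** Take two independent copies and exchange their parts outside [Q]. This involution [sw] preserves
    the product weight and turns [A u.1 && B u.2] into [A u.1 && B u.1]. *)
Lemma Pr_indep (Q : {set T}) A B :
  determined (fun e => e \in Q) A -> determined (fun e => e \notin Q) B ->
  Pr (fun H => A H && B H) = Pr A * Pr B.
Proof.
move=> dA dB.
pose sw (u : {set T} * {set T}) :=
  ((u.1 :&: Q) :|: (u.2 :\: Q), (u.2 :&: Q) :|: (u.1 :\: Q)).
have swK : involutive sw.
  case=> H H'; rewrite /sw /=; congr (_, _); apply/setP=> e; rewrite !inE;
  by case: (e \in H); case: (e \in H'); case: (e \in Q).
transitivity (\rsum_(u : {set T} * {set T} | A u.1 && B u.2) (wt u.1 * wt u.2)); last first.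
  rewrite /Pr big_distrlr /= pair_big_dep /=; exact: eq_bigl.
rewrite (reindex sw) /=; last by exists sw => u _; apply: swK.
transitivity (\rsum_(u : {set T} * {set T} | (A u.1 && B u.1) && predT u.2) (wt u.1 * wt u.2)).
  rewrite -(pair_big_dep (fun H => A H && B H) (fun _ => predT) (fun H H' => wt H * wt H')) /=.
  apply: eq_bigr => H _; rewrite -big_distrr /=.
  by have := Pr_total; rewrite /Pr => ->; rewrite Rmult_1_r.
apply: eq_big => [[H H'] | [H H'] _] /=; rewrite ?andbT.
  congr (_ && _); [apply: dA | apply: dB] => e; rewrite !inE.
    by move->; rewrite andbT /= orbF.
  by move=> /negbTE->; rewrite andbF.
rewrite /wt -!big_split /=; apply: eq_bigr => e _; rewrite !inE.
by case: (e \in H); case: (e \in H'); case: (e \in Q) => /=; ring.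
Qed.

Lemma Pr_avoid Q : Pr (fun H => [disjoint Q & H]) = \rprod_(e | e \in Q) (1 - p e).
Proof.
rewrite big_mkcond /=.
(* The product of these sums expands over all [H]; the zeros kill exactly the [H] that meet [Q]. *)
transitivity (\rprod_e ((if e \in Q then 0 else p e) + (1 - p e))); last first.
  by apply: eq_bigr => e _; case: (e \in Q) => /=; ring.
rewrite bigA_distr /Pr big_mkcond /=; apply: eq_bigr => H _.
case: ifPn => [/disjointFr QH | nQH].
  by apply: eq_bigr => e _; case: ifP => // eH; case: ifP => // /QH; rewrite eH.
have /existsP[e /andP[eQ eH]] : [exists e, (e \in Q) && (e \in H)].
  apply: contraNT nQH => /existsPn h; rewrite disjoint_subset; apply/subsetP=> e eQ.
  by have := h e; rewrite eQ /= inE.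
by rewrite (bigD1 e) //= eQ eH Rmult_0_l.
Qed.

Hypothesis p01 : forall e, 0 <= p e <= 1.

Lemma wt_ge0 H : 0 <= wt H.
Proof. by apply: rprod_ge0 => e; have := p01 e; case: ifP => _; lra. Qed.

Lemma Pr_ge0 A : 0 <= Pr A.
Proof. by apply: rsum_ge0 => H _; apply: wt_ge0. Qed.

Lemma Pr_le A B : (forall H, A H -> B H) -> Pr A <= Pr B.
Proof. by move=> AB; apply: rsum_sub => //; apply: wt_ge0. Qed.

Lemma Pr_le1 A : Pr A <= 1.
Proof. by rewrite -Pr_total; apply: Pr_le. Qed.

Lemma Pr_or A B : Pr (fun H => A H || B H) <= Pr A + Pr B.
Proof.
rewrite (Pr_split _ A) (eq_Pr (A := fun H => A H && (A H || B H)) (B := A)); last first.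
  by move=> H; case: (A H).
suff : Pr (fun H => ~~ A H && (A H || B H)) <= Pr B by lra.
by apply: Pr_le => H; case: (A H).
Qed.

Lemma Pr_exists (I : finType) (P : pred I) (F : I -> pred {set T}) :
  Pr (fun H => [exists i, P i && F i H]) <= \rsum_(i | P i) Pr (F i).
Proof.
rewrite /Pr (exchange_big_dep predT) //=.
rewrite [X in _ <= X](bigID (fun H => [exists i, P i && F i H])) /=.
rewrite -[X in X <= _]Rplus_0_r; apply: Rplus_le_compat; last first.
  by apply: rsum_ge0 => H _; apply: rsum_ge0 => i _; apply: wt_ge0.
apply: rsum_le => H /existsP[i Pi]; rewrite (bigD1 i) //=.
rewrite -[X in X <= _]Rplus_0_r; apply: Rplus_le_compat_l.
by apply: rsum_ge0 => *; apply: wt_ge0.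
Qed.

End ProductMeasure.

(** * Binomial expectations *)

(** The expectation of f (k + X) for X binomial with parameters m and q, one coin at a time. *)
Fixpoint binomE (q : R) (m : nat) (f : nat -> R) (k : nat) : R :=
  if m is m'.+1 then q * binomE q m' f k.+1 + (1 - q) * binomE q m' f k else f k.

Section BinomialExpectation.
Variable q : R.

Lemma binomE_le m f g k : 0 <= q <= 1 -> (forall i, f i <= g i) ->
  binomE q m f k <= binomE q m g k.
Proof.
move=> q01 fg; elim: m k => [|m IH] k /=; first exact: fg.
have h0 := IH k; have h1 := IH k.+1; nra.
Qed.

Lemma binomE_ge0 m f k : 0 <= q <= 1 -> (forall i, 0 <= f i) -> 0 <= binomE q m f k.
Proof.
move=> q01 f0; elim: m k => [|m IH] k /=; first exact: f0.
by have h0 := IH k; have h1 := IH k.+1; nra.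
Qed.

Lemma binomE_scale c m f k : binomE q m (fun i => c * f i) k = c * binomE q m f k.
Proof. by elim: m k => [|m IH] k //=; rewrite !IH; ring. Qed.

Lemma binomE_affine c d m f k :
  binomE q m (fun i => c + d * f i) k = c + d * binomE q m f k.
Proof. by elim: m k => [|m IH] k //=; rewrite !IH; ring. Qed.

Lemma eq_binomE m f g k : f =1 g -> binomE q m f k = binomE q m g k.
Proof. by move=> fg; elim: m k => [|m IH] k //=; rewrite !IH. Qed.

Lemma binomE_pow z m k : binomE q m (fun i => z ^ i) k = z ^ k * (1 + q * (z - 1)) ^ m.
Proof. by elim: m k => [|m IH] k /=; rewrite ?IH /=; ring. Qed.

(** Exponential change of measure: the weight z^X turns one binomial law into another, up to the
    generating function of X. *)
Lemma binomE_tilt z m f k : 1 + q * (z - 1) <> 0 ->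
  binomE q m (fun i => z ^ i * f i) k =
  z ^ k * (1 + q * (z - 1)) ^ m * binomE (q * z / (1 + q * (z - 1))) m f k.
Proof.
move=> B0; elim: m k => [|m IH] k /=; first by ring.
by rewrite !IH /=; field.
Qed.

Lemma binomE_quadratic a b c m k :
  binomE q m (fun i => a + b * INR i + c * INR i ^ 2) k =
  a + b * (INR k + INR m * q) +
  c * ((INR k + INR m * q) ^ 2 + INR m * q * (1 - q)).
Proof.
elim: m k => [|m IH] k; first by rewrite /=; ring.
by rewrite [LHS]/= !IH !S_INR; ring.
Qed.

End BinomialExpectation.

(** The expectation of [phi] at [N] enlarged by a random subset of [us]. It tracks the set itself,
    since the future of the exploration depends on it; [treeE_ge] and [treeE_le] then pass to
    cardinalities. *)
Fixpoint treeE (V : finType) (q : R) (us : seq V) (phi : {set V} -> R) (N : {set V}) : R :=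
  if us is w :: us' then q * treeE q us' phi (w |: N) + (1 - q) * treeE q us' phi N
  else phi N.

Section TreeExpectation.
Variables (V : finType) (q : R).
Hypothesis q01 : 0 <= q <= 1.

Lemma treeE_ge us (phi : {set V} -> R) psi (N : {set V}) :
  uniq us -> {in us, forall w, w \notin N} ->
  (forall N' : {set V}, {subset N <= N'} -> {subset N' <= [predU N & us]} -> psi #|N'| <= phi N') ->
  binomE q (size us) psi #|N| <= treeE q us phi N.
Proof.
elim: us N => [|w us IH] N /=; first by move=> _ _ h; apply: h => // x; rewrite !inE orbF.
case/andP=> wus uus usN h.
have wN : w \notin N by apply: usN; rewrite mem_head.
have h1 : binomE q (size us) psi #|N|.+1 <= treeE q us phi (w |: N).
  have -> : #|N|.+1 = #|w |: N| by rewrite cardsU1 wN.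
  apply: IH => // [w' w'us | N' NN' N'us].
    rewrite !inE negb_or usN ?inE ?w'us ?orbT // andbT.
    by apply: contraNneq wus => <-.
  apply: h => x; first by move=> xN; apply: NN'; rewrite !inE xN orbT.
  by move/N'us; rewrite !inE; case: (x == w); case: (x \in N); case: (x \in us).
have h2 : binomE q (size us) psi #|N| <= treeE q us phi N.
  apply: IH => // [w' w'us | N' NN' N'us]; first by apply: usN; rewrite inE w'us orbT.
  apply: h => // x; move/N'us; rewrite !inE.
  by case: (x == w); case: (x \in N); case: (x \in us).
case: q01 => q0 q1; apply: Rplus_le_compat; apply: Rmult_le_compat_l => //; lra.
Qed.

Lemma treeE_opp us (phi : {set V} -> R) N :
  treeE q us (fun N => - phi N) N = - treeE q us phi N.
Proof. by elim: us N => //= w us IH N; rewrite !IH; ring. Qed.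

Lemma treeE_le us (phi : {set V} -> R) psi (N : {set V}) :
  uniq us -> {in us, forall w, w \notin N} ->
  (forall N' : {set V}, {subset N <= N'} -> {subset N' <= [predU N & us]} -> phi N' <= psi #|N'|) ->
  treeE q us phi N <= binomE q (size us) psi #|N|.
Proof.
move=> uus usN h.
have := @treeE_ge us (fun N => - phi N) (fun i => -1 * psi i) N uus usN.
rewrite treeE_opp binomE_scale => h'.
suff : -1 * binomE q (size us) psi #|N| <= - treeE q us phi N by lra.
by apply: h' => N' NN' N'us; have := h N' NN' N'us; lra.
Qed.

End TreeExpectation.

(* [1 - (1 - a) * b] is the success probability of an attempt of success
   probability [a] followed, on failure, by one that fails with probability [b]. *)
Lemma retry_le1 (a b : R) : a <= 1 -> 0 <= b -> 1 - (1 - a) * b <= 1.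
Proof. by move=> a1 b0; nra. Qed.

Lemma retry_dead (a b : R) : a <= 0 -> 0 <= b -> 1 - (1 - a) * b <= 1 - b.
Proof. by move=> a1 b0; nra. Qed.

Lemma retry_step (a b c : R) : 0 <= b -> a <= c -> 1 - (1 - a) * b <= 1 - b + b * c.
Proof. by move=> a1 b0; nra. Qed.

(** * The exploration process *)

Section Exploration.
Variables (n : nat) (p2 p3 : R).
Hypotheses (p2_01 : 0 <= p2 <= 1) (p3_01 : 0 <= p3 <= 1).
Local Notation V := ('I_n).
Local Notation Hyp := {set {set 'I_n}}.

Definition pe (e : {set V}) : R :=
  if (#|e| == 2)%N then p2 else if (#|e| == 3)%N then p3 else 0.

Lemma pe01 e : 0 <= pe e <= 1.
Proof. by rewrite /pe; case: ifP => _ //; case: ifP => _ //; split; lra. Qed.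

(* The edges not yet examined once the vertices of [Z] are burnt. *)
Definition fresh (Z e : {set V}) := (1 < #|e :\: Z|)%N.

Lemma freshW (Z Z' e : {set V}) : Z \subset Z' -> fresh Z' e -> fresh Z e.
Proof. by move=> ZZ' h; apply: leq_trans h _; apply: subset_leq_card; apply: setDS. Qed.

(** The edges through which processing [x] can infect [w]. Leaving out third vertices burnt in
    earlier trials makes the probability of a hit depend only on [#|P|]. *)
Definition links (P : {set V}) (x w : V) : Hyp :=
  [set x; w] |: [set [set x; y; w] | y in P].

Definition newly (P : {set V}) (x : V) (us : seq V) (H : Hyp) : {set V} :=
  [set w in us | ~~ [disjoint links P x w & H]].

Definition hit (j : nat) : R := 1 - (1 - p2) * (1 - p3) ^ j.

Lemma hit01 j : 0 <= hit j <= 1.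
Proof.
case: p2_01 p3_01 => a0 a1 [b0 b1].
have h0 : 0 <= (1 - p3) ^ j by apply: pow_le; lra.
have h1 : (1 - p3) ^ j <= 1 by rewrite -[X in _ <= X](pow1 j); apply: pow_incr; lra.
by rewrite /hit; split; nra.
Qed.

Lemma links_new (Z P : {set V}) x w e :
  x \notin Z -> P \subset Z -> w \notin x |: Z -> e \in links P x w ->
  e :\: (x |: Z) = [set w].
Proof.
move=> xZ PZ; rewrite !inE negb_or => /andP[wx wZ].
case/orP=> [/eqP->|/imsetP[y yP ->]]; apply/setP=> u; rewrite !inE.
  by case: (eqVneq u w) => [->|uw]; rewrite ?(negbTE wx) ?(negbTE wZ) ?eqxx // ?orbF;
    case: (u == x); rewrite ?andbF.
have yZ : y \in Z by apply: (subsetP PZ).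
case: (eqVneq u w) => [->|uw]; first by rewrite (negbTE wx) (negbTE wZ) ?eqxx orbT.
by case: (eqVneq u x) => //= _; case: (eqVneq u y) => [->|_] //=; rewrite ?yZ ?andbF.
Qed.

Lemma Pr_unlinked (P : {set V}) x w : x \notin P -> w \notin x |: P ->
  Pr pe (fun H => [disjoint links P x w & H]) = (1 - p2) * (1 - p3) ^ #|P|.
Proof.
move=> xP; rewrite !inE negb_or => /andP[wx wP].
have c2 : #|[set x; w]| = 2%N by rewrite cards2 eq_sym wx.
have c3 y : y \in P -> #|[set x; y; w]| = 3%N.
  move=> yP; rewrite setUC cardsU1 cards2 !inE negb_or wx /=.
  have -> : (w != y) by apply: contraNneq wP => ->.
  by have -> : (x != y) by apply: contraNneq xP => ->.
rewrite Pr_avoid big_setU1 /=; last first.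
  by apply/imsetP=> -[y yP E]; have := c3 y yP; rewrite -E c2.
rewrite {1}/pe c2 eqxx; congr (_ * _).
rewrite big_imset /=; last first.
  move=> y y' yP y'P /setP/(_ y); rewrite !inE eqxx orbT /=.
  have /negbTE-> : y != x by apply: contraNneq xP => <-.
  have /negbTE-> : y != w by apply: contraNneq wP => <-.
  by rewrite orbF => /esym/eqP.
rewrite -rprod_pow; apply: eq_bigr => y yP.
by rewrite /pe c3.
Qed.

(* Links towards different vertices [w] are different edges, and none of them
   is fresh once [x] is burnt, so a step of the exploration is a sequence of
   independent coin tosses, independent of the future. *)
Lemma Pr_reveal (Z P : {set V}) x us (F : {set V} -> pred Hyp) N :
  x \notin Z -> P \subset Z -> uniq us -> {in us, forall w, w \notin x |: Z} ->
  (forall N, determined (fresh (x |: Z)) (F N)) ->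
  Pr pe (fun H => F (N :|: newly P x us H) H) =
  treeE (hit #|P|) us (fun N => Pr pe (F N)) N.
Proof.
move=> xZ PZ uus usZ dF; elim: us N uus usZ => [|w us IH] N /=.
  move=> _ _; apply: eq_Pr => H; congr (F _ H); apply/setP=> u.
  by rewrite !inE orbF.
case/andP=> wus uus usZ.
have wZ : w \notin x |: Z by apply: usZ; rewrite mem_head.
have usZ' : {in us, forall w', w' \notin x |: Z}.
  by move=> w' w'us; apply: usZ; rewrite inE w'us orbT.
have xP : x \notin P by apply: contra xZ; apply: (subsetP PZ).
have wP : w \notin x |: P.
  by apply: contra wZ; rewrite !inE => /orP[->//|/(subsetP PZ)->]; rewrite orbT.
have dA : determined (fun e => e \in links P x w) (fun H => [disjoint links P x w & H]).
  move=> H H' HH'; rewrite !disjoint_subset; apply/subsetP/subsetP=> h e eL;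
  by have := h e eL; rewrite !inE HH'.
have dB N' : determined (fun e => e \notin links P x w) (fun H => F (N' :|: newly P x us H) H).
  move=> H H' HH'.
  have -> : newly P x us H = newly P x us H'.
    apply/setP=> u; rewrite !inE; case: (boolP (u \in us)) => //= uu; congr (~~ _).
    have agree e : e \in links P x u -> (e \in H) = (e \in H').
      move=> eu; apply: HH'; apply/negP=> ew.
      have := links_new xZ PZ wZ ew; rewrite (links_new xZ PZ (usZ' u uu) eu).
      by move/set1_inj => E; rewrite -E uu in wus.
    rewrite !disjoint_subset; apply/subsetP/subsetP=> h e eL;
    by have := h e eL; rewrite !inE agree.
  apply: dF => e fe; apply: HH'; apply/negP=> ew.
  by move: fe; rewrite /fresh (links_new xZ PZ wZ ew) cards1.
have PA : Pr pe (fun H => [disjoint links P x w & H]) = 1 - hit #|P|.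
  by rewrite Pr_unlinked // /hit; ring.
have PB : Pr pe (fun H => ~~ [disjoint links P x w & H]) = hit #|P|.
  by rewrite Pr_compl PA; ring.
rewrite (Pr_split _ _ (fun H => [disjoint links P x w & H])) Rplus_comm; congr (_ + _).
  rewrite -IH // -PB -(@Pr_indep _ pe (links P x w));
    [ | by move=> H H' HH'; rewrite (dA H H' HH') | exact: dB].
  apply: eq_Pr => H; case: (boolP [disjoint _ & _]) => //= nd.
  congr (F _ H); apply/setP=> u; rewrite !inE.
  by case: (eqVneq u w) => [->|_] //=; rewrite ?nd ?orbT ?orbF.
rewrite -IH // -PA -(@Pr_indep _ pe (links P x w)); [ | exact: dA | exact: dB].
apply: eq_Pr => H; case: (boolP [disjoint _ & _]) => //= nd.
congr (F _ H); apply/setP=> u; rewrite !inE.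
by case: (eqVneq u w) => [->|_] //=; rewrite nd (negbTE wus) ?andbF.
Qed.

(* In the lower bound every step examines exactly [N] candidates and the process
   stops once [cap] vertices are active; the upper bound uses [N = n] and
   [cap = n.+1], which disables both. *)
Variables (N cap : nat).

Definition scan (Z A : {set V}) : seq V := take N (enum (~: (Z :|: A))).

Lemma scan_uniq Z A : uniq (scan Z A).
Proof. by apply: take_uniq; apply: enum_uniq. Qed.

Lemma mem_scan Z A w : w \in scan Z A -> (w \notin Z) && (w \notin A).
Proof. by move/mem_take; rewrite mem_enum !inE negb_or. Qed.

(* [Z]: all burnt vertices, [P]: those burnt in the current trial, [A]: active.
   [k] more vertices are to be burnt; when the trial dies out, [cont] takes over. *)
Fixpoint explore (k : nat) (cont : {set V} -> pred Hyp) (Z P A : {set V}) (H : Hyp) : bool :=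
  if (cap <= #|A|)%N then true else
  if k is k'.+1 then
    if [pick x in A] is Some x then
      explore k' cont (x |: Z) (x |: P) ((A :\ x) :|: newly P x (scan Z A) H) H
    else cont Z H
  else true.

(** Every link read joins two vertices outside [Z], so it is fresh; later stages read less, because
    freshness only shrinks as [Z] grows. *)
Lemma explore_determined k cont (Z P A : {set V}) :
  (forall Z', determined (fresh Z') (cont Z')) -> P \subset Z -> [disjoint A & Z] ->
  determined (fresh Z) (explore k cont Z P A).
Proof.
move=> dc; elim: k Z P A => [|k IH] Z P A PZ AZ H H' HH' /=; first by [].
case: ifP => // _; case: pickP => [x xA | _]; last exact: dc.
have xZ : x \notin Z by rewrite (disjointFr AZ xA).
have -> : newly P x (scan Z A) H = newly P x (scan Z A) H'.
  apply/setP=> u; rewrite !inE; case: (boolP (u \in _)) => //= /mem_scan/andP[uZ uA].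
  have ux : u != x by apply: contraNneq uA => ->.
  have agree e : e \in links P x u -> (e \in H) = (e \in H').
    move=> eu; apply: HH'; rewrite /fresh.
    have uxZ : u \notin x |: Z by rewrite !inE negb_or ux.
    have <- : #|[set x; u]| = 2%N by rewrite cards2 eq_sym ux.
    apply: subset_leq_card; apply/subsetP=> t; rewrite !inE => /orP[]/eqP->.
      rewrite xZ; move: eu; rewrite !inE => /orP[/eqP->|/imsetP[y _ ->]]; by rewrite !inE eqxx.
    by rewrite uZ; move: eu; rewrite !inE => /orP[/eqP->|/imsetP[y _ ->]]; rewrite !inE eqxx ?orbT.
  congr (~~ _); rewrite !disjoint_subset; apply/subsetP/subsetP=> h e eL;
  by have := h e eL; rewrite !inE agree.
apply: IH => [||e]; last by move=> fe; apply: HH'; apply: freshW fe; apply: subsetUr.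
- exact: setUS.
rewrite disjoint_subset; apply/subsetP=> u; rewrite !inE negb_or.
case/orP=> [/andP[-> uA]|/andP[us _]]; first by rewrite (disjointFr AZ uA).
case/andP: (mem_scan us) => -> uA; rewrite andbT.
by apply: contraNneq uA => ->.
Qed.


Lemma newly_scan (Z P A : {set V}) (H : Hyp) x : x \in A ->
  newly P x (scan Z A) H :\: (x |: Z) = newly P x (scan Z A) H.
Proof.
move=> xA; apply/setP=> u; rewrite !inE.
case: (boolP (u \in scan Z A)) => [/mem_scan/andP[uZ uA]|]; last by rewrite andbF.
by rewrite (negbTE uZ) orbF (_ : u != x) //; apply: contraNneq uA => ->.
Qed.

Lemma next_disjoint (Z A N' : {set V}) x : [disjoint A & Z] ->
  [disjoint (A :\ x) :|: (N' :\: (x |: Z)) & x |: Z].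
Proof.
move=> AZ; rewrite disjoint_subset; apply/subsetP=> u; rewrite !inE.
case: (eqVneq u x) => //= ux; rewrite ?orbF => /orP[uA|/andP[//]].
by rewrite (disjointFr AZ uA).
Qed.

(** [Pr_reveal] ranges over all sets [N], even those meeting the burnt vertices. Removing [x |: Z]
    keeps the active set disjoint from the burnt one for each of them, and by [newly_scan] changes
    nothing for the sets that occur. *)
Lemma explore_step k cont (Z P A : {set V}) x :
  (forall Z', determined (fresh Z') (cont Z')) -> P \subset Z -> [disjoint A & Z] ->
  x \in A ->
  Pr pe (fun H => explore k cont (x |: Z) (x |: P) ((A :\ x) :|: newly P x (scan Z A) H) H) =
  treeE (hit #|P|) (scan Z A)
    (fun N => Pr pe (explore k cont (x |: Z) (x |: P) ((A :\ x) :|: (N :\: (x |: Z))))) set0.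
Proof.
move=> dc PZ AZ xA; have xZ : x \notin Z by rewrite (disjointFr AZ xA).
rewrite -(@Pr_reveal Z P x (scan Z A) (fun N => explore k cont (x |: Z) (x |: P)
  ((A :\ x) :|: (N :\: (x |: Z))))) //.
- by apply: eq_Pr => H; rewrite set0U newly_scan.
- exact: scan_uniq.
- move=> w /mem_scan/andP[wZ wA]; rewrite !inE negb_or wZ andbT.
  by apply: contraNneq wA => ->.
move=> N'; apply: explore_determined => //; first exact: setUS.
exact: next_disjoint.
Qed.

Lemma card_next (Z A : {set V}) x (N' : {set V}) : x \in A -> 
  {subset N' <= [predU set0 & scan Z A]} ->
  #|(A :\ x) :|: (N' :\: (x |: Z))| = (#|A|.-1 + #|N'|)%N.
Proof.
move=> xA N'us.
have h u : u \in N' -> (u \notin Z) && (u \notin A).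
  by move/N'us; rewrite !inE; apply: mem_scan.
have -> : N' :\: (x |: Z) = N'.
  apply/setP=> u; rewrite !inE; case: (boolP (u \in N')) => [/h/andP[uZ uA]|]; rewrite ?andbF //.
  by rewrite (negbTE uZ) orbF andbT; apply: contraNneq uA => ->.
rewrite cardsU (_ : (A :\ x) :&: N' = set0) ?cards0 ?subn0; last first.
  apply/setP=> u; rewrite !inE; apply/negP=> /andP[/andP[_ uA] /h/andP[_]].
  by rewrite uA.
by rewrite (cardsD1 x A) xA.
Qed.

Lemma size_scan (Z A : {set V}) : [disjoint A & Z] -> size (scan Z A) = minn N (n - #|Z| - #|A|).
Proof.
move=> AZ; rewrite /scan size_take_min -cardE [#|~: _|]cardsCs setCK cardsU card_ord.
have -> : Z :&: A = set0 by rewrite setIC; apply/eqP; rewrite setI_eq0.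
by rewrite cards0 subn0 subnDA.
Qed.

(** Here [v] is a subsolution for the survival of one trial and [R0] bounds the failure probability
    of what follows a dead trial. At most [m] vertices are ever burnt, so [N + m + cap <= n]
    guarantees [N] candidates at every step. *)
Lemma explore_ge (K m : nat) (v : nat -> nat -> R) (R0 : R) cont :
  (cap <= n)%N ->
  0 <= R0 ->
  (forall j a, j = K \/ (cap <= a)%N -> v j a <= 1) ->
  (forall j, v j 0%N <= 0) ->
  (forall j a, (j < K)%N -> (a.+1 < cap)%N ->
     v j a.+1 <= binomE (hit j) N (fun i => v j.+1 (a + i)%N) 0) ->
  (forall Z', determined (fresh Z') (cont Z')) ->
  (forall Z' : {set V}, (#|Z'| <= m)%N -> 1 - R0 <= Pr pe (cont Z')) ->
  (N + m + cap <= n)%N ->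
  forall k (Z P A : {set V}), (#|P| + k = K)%N -> P \subset Z -> [disjoint A & Z] ->
  (#|Z| + k <= m)%N ->
  1 - (1 - v #|P| #|A|) * R0 <= Pr pe (explore k cont Z P A).
Proof.
move=> capn R00 v1 v0 vstep dc hc Nm; elim=> [|k IH] Z P A Pk PZ AZ Zk.
  have -> : Pr pe (explore 0 cont Z P A) = Pr pe predT.
    by apply: eq_Pr => H /=; case: ifP.
  rewrite Pr_total; have := v1 #|P| #|A|; rewrite -Pk addn0 => h.
  by apply: retry_le1 => //; apply: h; left.
rewrite /=; case: (leqP cap #|A|) => capA.
  by rewrite Pr_total; apply: retry_le1 => //; apply: v1; right.
case: pickP => [x xA | A0]; last first.
  have -> : A = set0 by apply/setP=> u; rewrite inE; apply: A0.
  rewrite cards0; apply: Rle_trans (hc Z _); last by lia.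
  by apply: retry_dead => //; apply: v0.
rewrite (_ : Pr pe _ = Pr pe (fun H => explore k cont (x |: Z) (x |: P)
  ((A :\ x) :|: newly P x (scan Z A) H) H)); last by [].
rewrite explore_step //.
have xZ : x \notin Z by rewrite (disjointFr AZ xA).
have xP : x \notin P by apply: contra xZ; apply: (subsetP PZ).
have cA : #|A| = #|A|.-1.+1 by rewrite (cardsD1 x A) xA.
apply: Rle_trans (treeE_ge (psi := fun i => 1 - (1 - v #|P|.+1 (#|A|.-1 + i)%N) * R0)
   (hit01 _) (scan_uniq _ _) _ _); last first.
- move=> N' _ N'us; rewrite -(card_next xA N'us).
  have -> : #|P|.+1 = #|x |: P| by rewrite cardsU1 xP.
  apply: IH.
  - by rewrite cardsU1 xP add1n addSn -addnS.
  - exact: setUS.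
  - exact: next_disjoint.
  - by rewrite cardsU1 xZ add1n addSn -addnS.
- by move=> w _; rewrite inE.
rewrite cards0 size_scan // (_ : minn _ _ = N); last by lia.
have := @vstep #|P| #|A|.-1; rewrite -cA => h.
have {h} h : v #|P| #|A| <= binomE (hit #|P|) N (fun i => v #|P|.+1 (#|A|.-1 + i)%N) 0.
  by apply: h => //; lia.
(* The bound is affine and increasing in [v], so the inequality for [v] passes through the
   expectation. *)
rewrite (@eq_binomE _ _ _ (fun i => (1 - R0) + R0 * v #|P|.+1 (#|A|.-1 + i)%N)).
  by rewrite binomE_affine; apply: retry_step.
by move=> i; ring.
Qed.

(** The step inequality is asked for every [m <= n] because the number of untouched candidates
    varies with the state. *)
Lemma explore_le (K : nat) (g : nat -> nat -> R) :
  (n < cap)%N ->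
  (forall j a, (j <= K)%N -> 0 <= g j a) ->
  (forall a, 1 <= g K a) ->
  (forall j a m, (j < K)%N -> (m <= n)%N ->
     binomE (hit j) m (fun i => g j.+1 (a + i)%N) 0 <= g j a.+1) ->
  forall k (Z P A : {set V}), (#|P| + k = K)%N -> P \subset Z -> [disjoint A & Z] ->
  Pr pe (explore k (fun _ => pred0) Z P A) <= g #|P| #|A|.
Proof.
move=> capn g0 g1 gstep; elim=> [|k IH] Z P A Pk PZ AZ.
  apply: Rle_trans (Pr_le1 pe01 _) _.
  by rewrite -[#|P|]addn0 Pk; apply: g1.
rewrite /=; case: (leqP cap #|A|) => capA.
  by have := leq_trans capA (max_card _); rewrite card_ord leqNgt capn.
case: pickP => [x xA | A0]; last first.
  by rewrite Pr_pred0; apply: g0; rewrite -Pk leq_addr.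
rewrite (_ : Pr pe _ = Pr pe (fun H => explore k (fun=> pred0) (x |: Z) (x |: P)
  ((A :\ x) :|: newly P x (scan Z A) H) H)); last by [].
rewrite explore_step //.
have xZ : x \notin Z by rewrite (disjointFr AZ xA).
have xP : x \notin P by apply: contra xZ; apply: (subsetP PZ).
have cA : #|A| = #|A|.-1.+1 by rewrite (cardsD1 x A) xA.
apply: Rle_trans (treeE_le (psi := fun i => g #|P|.+1 (#|A|.-1 + i)%N)
   (hit01 _) (scan_uniq _ _) _ _) _.
- by move=> w _; rewrite inE.
- move=> N' _ N'us; rewrite -(card_next xA N'us).
  have -> : #|P|.+1 = #|x |: P| by rewrite cardsU1 xP.
  apply: IH.
  - by rewrite cardsU1 xP add1n addSn -addnS.
  - exact: setUS.
  - exact: next_disjoint.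
rewrite cards0 [X in g _ X]cA; apply: gstep.
  by rewrite -Pk addnS ltnS leq_addr.
rewrite size_scan //; apply: leq_trans (geq_minr _ _) _.
by apply: leq_trans (leq_subr _ _) (leq_subr _ _).
Qed.

(** A trial dies when no vertex is active, so all that it infected is burnt: at most [K] vertices
    are withheld from the later trials. *)
Fixpoint trials (K T : nat) (Z : {set V}) (H : Hyp) : bool :=
  if T is T'.+1 then
    if [pick v | v \notin Z] is Some v then explore K (trials K T') Z set0 [set v] H
    else false
  else false.

Lemma trials_determined K T Z : determined (fresh Z) (trials K T Z).
Proof.
elim: T Z => [|T IH] Z H H' HH' //=; case: pickP => // v vZ.
apply: explore_determined HH' => //; first exact: sub0set.
by rewrite disjoints1.
Qed.

(** The step inequalities force this bound: with [R0 = 1] and a continuation that always fails,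
    [explore_ge] places [v 0 1] below a probability. *)
Lemma explore_value_le1 (K : nat) (v : nat -> nat -> R) :
  (0 < n)%N -> (N + K + cap <= n)%N ->
  (forall j a, j = K \/ (cap <= a)%N -> v j a <= 1) ->
  (forall j, v j 0%N <= 0) ->
  (forall j a, (j < K)%N -> (a.+1 < cap)%N ->
     v j a.+1 <= binomE (hit j) N (fun i => v j.+1 (a + i)%N) 0) ->
  v 0%N 1%N <= 1.
Proof.
move=> n0 NKn v1 v0 vstep; have capn : (cap <= n)%N by lia.
pose x := Ordinal n0.
have := @explore_ge K K v 1 (fun _ => pred0) capn Rle_0_1 v1 v0 vstep _ _ _ K set0 set0 [set x].
rewrite !cards0 cards1 => h; apply: Rle_trans (Pr_le1 pe01 _); last first.
apply: Rle_trans (h _ _ _ _ _ _ _) => //.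
- by lra.
- by move=> Z' _; rewrite Pr_pred0; lra.
- by rewrite disjoints1 inE.
Qed.

Lemma trials_ge (K : nat) (v : nat -> nat -> R) (T : nat) :
  (cap <= n)%N -> (0 < N)%N ->
  (forall j a, j = K \/ (cap <= a)%N -> v j a <= 1) ->
  (forall j, v j 0%N <= 0) ->
  (forall j a, (j < K)%N -> (a.+1 < cap)%N ->
     v j a.+1 <= binomE (hit j) N (fun i => v j.+1 (a + i)%N) 0) ->
  (forall Z : {set V}, (N + (#|Z| + T * K) + cap <= n)%N ->
    1 - (1 - v 0%N 1%N) ^ T <= Pr pe (trials K T Z)).
Proof.
move=> capn N0 v1 v0 vstep; elim: T => [|T IH] Z ZT.
  by rewrite /= Pr_pred0; lra.
rewrite /=; case: pickP => [x xZ | Z0]; last first.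
  have : #|~: Z| = 0%N by apply: eq_card0 => u; rewrite inE; apply: Z0.
  by rewrite cardsCs setCK card_ord; lia.
rewrite (_ : Pr pe _ = Pr pe (explore K (trials K T) Z set0 [set x])); last by [].
have := @explore_ge K (#|Z| + K)%N v ((1 - v 0%N 1%N) ^ T) (trials K T) capn _ v1 v0 vstep
  (trials_determined K T) _ _ K Z set0 [set x].
rewrite cards0 cards1; apply.
- apply: pow_le; suff : v 0%N 1%N <= 1 by lra.
  by apply: explore_value_le1 vstep => //; [exact: leq_ltn_trans (ltn_ord x) | lia].
- by move=> Z' Z'm; apply: IH; nia.
- by nia.
- by [].
- exact: sub0set.
- by rewrite disjoints1.
- by [].
Qed.

End Exploration.

(** * Sets closed under propagation *)

Lemma card_grow (T : finType) (S e : {set T}) : #|S :|: e| = (#|S| + #|e :\: S|)%N.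
Proof. by rewrite cardsU cardsD (setIC S) addnBA // subset_leq_card // subsetIl. Qed.

Section Propagation.
Variable n : nat.
Local Notation V := ('I_n).
Local Notation Hyp := {set {set 'I_n}}.

(** The size condition excludes singletons, which could add a vertex without meeting [S]. *)
Definition prop_closed (H : Hyp) (S : {set V}) : bool :=
  [forall e in H, (1 < #|e|)%N ==> (#|e :\: S| != 1)%N].

(** The closure of the seed [v] is everything, expressed through closed sets so that no closure has
    to be built. *)
Definition spreads (H : Hyp) (v : V) : Prop :=
  forall S : {set V}, v \in S -> prop_closed H S -> S = setT.

Lemma prop_closedP (H : Hyp) (S : {set V}) :
  reflect (forall e : {set V}, e \in H -> (1 < #|e|)%N -> #|e :\: S| <> 1%N) (prop_closed H S).
Proof.
apply: (iffP forall_inP) => [h e eH e2|h e eH]; first by apply/eqP; move/implyP: (h e eH); apply.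
by apply/implyP=> e2; apply/eqP; apply: h.
Qed.

Lemma closed_sub (H : Hyp) (S e : {set V}) : prop_closed H S -> e \in H -> (1 < #|e|)%N ->
  (#|e :\: S| <= 1)%N -> e \subset S.
Proof.
move/prop_closedP=> h eH e2; have := h e eH e2.
by case E: #|e :\: S| => [|[|]] // _ _; rewrite -setD_eq0 -cards_eq0 E.
Qed.

Definition cover_upto (s : seq {set V}) (m : nat) := \bigcup_(i < m) nth set0 s i.

Lemma cover_uptoS s m : cover_upto s m.+1 = cover_upto s m :|: nth set0 s m.
Proof. by rewrite /cover_upto big_ord_recr. Qed.

Lemma cover_upto_rcons s e m : (m <= size s)%N -> cover_upto (rcons s e) m = cover_upto s m.
Proof.
move=> ms; apply: eq_bigr => i _; rewrite nth_rcons.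
by rewrite (leq_trans (ltn_ord i) ms).
Qed.

Lemma spreads_seq (H : Hyp) v : spreads H v -> forall m, (m < n)%N ->
  exists s : seq {set V}, [/\ size s = m, all (fun e => e \in H) s,
    #|v |: cover_upto s m| = m.+1, (0 < m)%N -> v \in cover_upto s m &
    forall l, (0 < l < m)%N -> #|nth set0 s l :&: cover_upto s l| = (#|nth set0 s l| - 1)%N].
Proof.
move=> sp; elim=> [|m IH] mn.
  exists [::]; split => //; first by rewrite /cover_upto big_ord0 setU0 cards1.
  by case.
have [s [sm sH cS vS hl]] := IH (ltnW mn).
set S := v |: cover_upto s m in cS.
have : ~~ prop_closed H S.
  apply/negP => /(sp S (setU11 _ _)) E; move: cS; rewrite E cardsT card_ord => E2.
  by rewrite E2 ltnn in mn.
case/forall_inPn=> e eH; rewrite negb_imply negbK => /andP[e2 /eqP eS].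
exists (rcons s e); split.
- by rewrite size_rcons sm.
- by rewrite all_rcons eH.
- rewrite cover_uptoS cover_upto_rcons ?sm // nth_rcons sm ltnn eqxx setUA.
  by rewrite -/S card_grow cS eS addn1.
- move=> _; rewrite cover_uptoS cover_upto_rcons ?sm // nth_rcons sm ltnn eqxx inE.
  case: (posnP m) => [m0|/vS->//]; apply/orP; right.
  have SE : S = [set v] by rewrite /S m0 /cover_upto big_ord0 setU0.
  apply: contraLR e2 => ve; rewrite -leqNgt -eS SE subset_leq_card //.
  by apply/subsetP=> u ue; rewrite !inE ue andbT; apply: contraNneq ve => <-.
- move=> l /andP[l0]; rewrite ltnS leq_eqVlt => /orP[/eqP lm|lm].
    rewrite lm cover_upto_rcons ?sm // nth_rcons sm ltnn eqxx.
    have -> : cover_upto s m = S.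
      by apply/esym/setUidPr; rewrite sub1set vS // -lm.
    by rewrite -eS cardsD subKn // subset_leq_card // subsetIl.
  rewrite cover_upto_rcons ?sm ?(ltnW lm) // nth_rcons sm lm.
  by apply: hl; rewrite l0.
Qed.

Lemma spreads_prop_connected (H : Hyp) v : spreads H v -> prop_connected H.
Proof.
move=> sp; have n0 : (0 < n)%N by case: n v {sp} => // -[].
have [|s [sm sH _ _ hl]] := spreads_seq sp (m := n.-1); first by rewrite prednK.
apply/existsP; exists (tcast sm (in_tuple s)); apply/andP; split.
  by rewrite val_tcast.
apply/forallP=> l; apply/implyP=> /andP[l0 _].
rewrite (tnth_nth set0) val_tcast /=; apply/eqP; apply: hl.
by rewrite l0 ltn_ord.
Qed.

Definition sizes23 (H : Hyp) := [forall e in H, (#|e| == 2)%N || (#|e| == 3)%N].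

Lemma prop_connected_spreads (H : Hyp) : (1 < n)%N -> sizes23 H -> prop_connected H ->
  exists v, spreads H v.
Proof.
move=> n1 /forall_inP h23 /existsP[t /andP[/allP tH /forallP ht]].
pose e i := nth set0 t i; pose U i := cover_upto t i.
have eH i : (i < n.-1)%N -> e i \in H by move=> i_n; apply: tH; apply: mem_nth; rewrite size_tuple.
have hi i : (0 < i < n.-1)%N -> #|e i :\: U i| = 1%N.
  case/andP=> i0 i_n; have := ht (Ordinal i_n); rewrite /= i0 (_ : (i <= n - 2)%N); last by lia.
  rewrite /= (tnth_nth set0) /= => /eqP E.
  rewrite cardsD; have := E; rewrite -/(cover_upto t i) -/(U i) -/(e i) => ->.
  by apply: subKn; case/orP: (h23 _ (eH i i_n)) => /eqP->.
have US i : (0 < i < n.-1)%N -> #|U i.+1| = #|U i|.+1.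
  by move=> h; rewrite /U cover_uptoS card_grow -/(U i) -/(e i) hi // addn1.
have U1 : U 1%N = e 0%N by rewrite /U cover_uptoS /cover_upto big_ord0 set0U.
have Uc i : (i < n.-1)%N -> #|U i.+1| = (#|e 0%N| + i)%N.
  elim: i => [|i IH] i_n; first by rewrite U1 addn0.
  by rewrite US // IH ?addnS // ltnW.
have n2 : (n.-2.+1 = n.-1)%N by lia.
have Un : #|U n.-1| = (#|e 0%N| + n.-2)%N by rewrite -[in LHS]n2 Uc // n2.
(* Each of the n - 2 later edges adds one vertex, so a first edge of size 3 would yield n + 1
   vertices. *)
have e02 : #|e 0%N| = 2%N.
  have /orP[/eqP//|/eqP E] := h23 _ (eH 0%N ltac:(lia)).
  have := max_card (mem (U n.-1)); rewrite Un E card_ord; lia.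
have UT : U n.-1 = setT.
  by apply/eqP; rewrite eqEcard subsetT cardsT card_ord Un e02; lia.
have [v ve] : exists v, v \in e 0%N by apply/card_gt0P; rewrite e02.
exists v => S vS cS; apply/eqP; rewrite -subTset -UT.
have gt1 i : (i < n.-1)%N -> (1 < #|e i|)%N by move=> /eH/h23/orP[]/eqP->.
suff h i : (i < n.-1)%N -> U i.+1 \subset S by rewrite -[in X in X \subset _]n2 h // n2.
elim: i => [|i IH] i_n.
  rewrite U1; apply: (closed_sub cS (eH _ _) (gt1 _ _)) => //.
  rewrite cardsD e02 leq_subLR addn1 ltnS card_gt0; apply/set0Pn; exists v.
  by rewrite inE ve.
rewrite /U cover_uptoS subUset IH ?(ltnW i_n) //=.
apply: (closed_sub cS (eH _ _) (gt1 _ _)) => //.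
rewrite -(@hi i.+1) //; apply: subset_leq_card; apply: setDS; exact: IH (ltnW i_n).
Qed.

Variables (N cap : nat).

(** A link to [w] has all its other vertices among [x] and [P], so a closed set containing these
    contains [w]. It therefore contains everything that the trial infects. *)
Lemma explore_sound (H : Hyp) K k cont (Z P A : {set V}) :
  (K <= cap)%N -> (#|P| + k = K)%N -> P \subset Z -> [disjoint A & Z] ->
  explore N cap k cont Z P A H ->
  (exists Z', cont Z' H) \/
  (forall S : {set V}, prop_closed H S -> P \subset S -> A \subset S -> (K <= #|S|)%N).
Proof.
move=> Kcap; elim: k Z P A => [|k IH] Z P A Pk PZ AZ /=.
  move=> _; right=> S _ PS _; rewrite -Pk addn0; exact: subset_leq_card.
case: ifP => [capA _|_].
  right=> S _ _ AS; apply: leq_trans Kcap (leq_trans capA _); exact: subset_leq_card.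
case: pickP => [x xA ex|_ cZ]; last by left; exists Z.
have xZ : x \notin Z by rewrite (disjointFr AZ xA).
have xP : x \notin P by apply: contra xZ; apply: (subsetP PZ).
have := IH _ _ _ _ _ _ ex; case.
- by rewrite cardsU1 xP add1n addSn -addnS.
- exact: setUS.
- by rewrite -newly_scan //; apply: next_disjoint.
- by left.
move=> h; right=> S cS PS AS; apply: h => //.
  by rewrite subUset sub1set (subsetP AS).
rewrite subUset (subset_trans (subsetDl _ _) AS) /=; apply/subsetP=> w; rewrite !inE => /andP[ws].
case/mem_scan/andP: ws => wZ wA.
have xw : x != w by apply: contraNneq wA => <-.
rewrite disjoint_subset => /subsetPn[e eL]; rewrite inE negbK => eH.
have xe : x \in e by move: eL; rewrite !inE => /orP[/eqP->|/imsetP[y _ ->]]; rewrite !inE eqxx.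
have we : w \in e.
  by move: eL; rewrite !inE => /orP[/eqP->|/imsetP[y _ ->]]; rewrite !inE eqxx ?orbT.
have wxZ : w \notin x |: Z by rewrite !inE negb_or eq_sym xw.
have e2 : (1 < #|e|)%N.
  have <- : #|[set x; w]| = 2%N by rewrite cards2 xw.
  by apply: subset_leq_card; apply/subsetP=> u; rewrite !inE => /orP[]/eqP->.
have eS : (#|e :\: S| <= 1)%N.
  have <- : #|[set w]| = 1%N by rewrite cards1.
  apply: subset_leq_card; apply/subsetP=> u; rewrite !inE => /andP[uS].
  have xS : x \in S by apply: (subsetP AS).
  move: eL; rewrite !inE => /orP[/eqP->|/imsetP[y yP ->]]; rewrite !inE.
    by case: (eqVneq u x) => [E|//]; rewrite E xS in uS.
  case: (eqVneq u x) => [E|_]; first by rewrite E xS in uS.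
  by case: (eqVneq u y) => [E|//]; rewrite E (subsetP PS) in uS.
by apply: (subsetP (closed_sub cS eH e2 eS)).
Qed.

Lemma trials_sound (H : Hyp) K T (Z : {set V}) : (K <= cap)%N -> trials N cap K T Z H ->
  exists v : V, forall S : {set V}, prop_closed H S -> v \in S -> (K <= #|S|)%N.
Proof.
move=> Kcap; elim: T Z => [|T IH] Z //=; case: pickP => // v vZ ex.
have := explore_sound Kcap _ _ _ ex; case.
- by rewrite cards0.
- exact: sub0set.
- by rewrite disjoints1.
- by case=> Z' /IH.
by move=> h; exists v => S cS vS; apply: h => //; rewrite ?sub0set ?sub1set.
Qed.

(** The invariant is the hypothesis on edges: the only vertex that an edge has outside [P] is
    active. When no vertex is active, [P] itself is closed. *)
Lemma explore_complete (H : Hyp) k (P A : {set V}) :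
  (n < cap)%N -> (n <= N)%N -> sizes23 H -> [disjoint A & P] ->
  (forall e : {set V}, e \in H -> #|e :\: P| = 1%N -> (1 < #|e|)%N -> e \subset P :|: A) ->
  ~~ explore N cap k (fun _ => pred0) P P A H ->
  exists S : {set V}, [/\ prop_closed H S, P \subset S, A \subset S & (#|S| < #|P| + k)%N].
Proof.
move=> ncap nN /forall_inP h23; elim: k P A => [|k IH] P A AP fr /=; first by case: ifP.
case: ifP => // _; case: pickP => [x xA ex|A0 _]; last first.
  have A0' : A = set0 by apply/setP=> u; rewrite inE; apply: A0.
  exists P; split; rewrite ?A0' ?sub0set // ?ltn_addS ?addnS ?ltnS ?leq_addr //.
  apply/prop_closedP=> e eH e2 E; have := fr e eH E e2; rewrite A0' setU0 -setD_eq0 -cards_eq0.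
  by rewrite E.
have xP : x \notin P by rewrite (disjointFr AP xA).
have [] := IH _ _ _ _ ex.
- by rewrite -newly_scan //; apply: next_disjoint.
- move=> e eH E e2.
  have [w Ew] : exists w, e :\: (x |: P) = [set w] by apply/cards1P; rewrite E.
  have we : w \in e :\: (x |: P) by rewrite Ew set11.
  move: we; rewrite !inE negb_or => /andP[/andP[wx wP] we].
  have other u : u \in e -> u != w -> u \in x |: P.
    move=> ue uw; apply: contraNT uw => uP.
    have : u \in e :\: (x |: P) by rewrite inE uP.
    by rewrite Ew inE.
  suff wn : w \in A :\ x :|: newly P x (scan N P A) H.
    apply/subsetP=> u ue; case: (eqVneq u w) => [->|/(other u ue) h]; first by rewrite inE wn orbT.
    by rewrite inE h.
  rewrite !inE wx /=; case: (boolP (w \in A)) => //= wA.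
  have -> /= : w \in scan N P A.
    rewrite /scan take_oversize; first by rewrite mem_enum !inE negb_or wP.
    by rewrite -cardE; apply: leq_trans (max_card _) _; rewrite card_ord.
  (* Otherwise [w] was already the only vertex of [e] outside [P], and the invariant would make it
     active. *)
  have xe : x \in e.
    apply/negPn/negP => xe; have EP : e :\: P = [set w].
      rewrite -Ew; apply/setP=> u; rewrite !inE negb_or; case: (eqVneq u x) => //= ->.
      by rewrite (negbTE xe) andbF.
    have := fr e eH; rewrite EP cards1 => /(_ erefl e2)/subsetP/(_ w we).
    by rewrite inE (negbTE wP) (negbTE wA).
  apply/pred0Pn; exists e => /=; rewrite eH andbT !inE.
  have xw : x != w by rewrite eq_sym.
  case/orP: (h23 e eH) => /eqP ce.
    apply/orP; left; rewrite eq_sym eqEcard cards2 xw ce leqnn andbT.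
    by apply/subsetP=> u; rewrite !inE => /orP[]/eqP->.
  apply/orP; right; apply/imsetP.
  have : #|e :\ x :\ w| = 1%N.
    have c2 : #|e :\ x| = 2%N by have := cardsD1 x e; rewrite xe ce add1n => -[<-].
    by have := cardsD1 w (e :\ x); rewrite c2 !inE wx we add1n => -[<-].
  move/eqP/cards1P=> [y Ey].
  have : y \in e :\ x :\ w by rewrite Ey set11.
  rewrite !inE => /and3P[yw yx ye].
  have yP : y \in P by have := other y ye yw; rewrite !inE (negbTE yx).
  exists y => //; apply/setP=> u; rewrite !inE.
  case: (eqVneq u x) => [->//|ux]; case: (eqVneq u w) => [->|uw]; first by rewrite orbT.
  have := erefl (u \in e :\ x :\ w); rewrite {2}Ey !inE ux uw /= orbF => ->.
  by [].
move=> S [cS PS AS Sk].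
have xS : x \in S by apply: (subsetP PS); rewrite setU11.
exists S; split => //.
- by apply: subset_trans PS; apply: subsetUr.
- apply/subsetP=> u uA; case: (eqVneq u x) => [->//|ux].
  by apply: (subsetP AS); rewrite !inE ux uA.
by move: Sk; rewrite cardsU1 xP add1n addSn addnS.
Qed.

End Propagation.

(** * Transfer to the product measure, and the first moment bound for closed sets *)

Section ClosedSets.
Variables (n : nat) (p2 p3 : R).
Hypotheses (p2_01 : 0 <= p2 <= 1) (p3_01 : 0 <= p3 <= 1).
Local Notation V := ('I_n).

Lemma hg_prob_Pr (P : pred {set {set V}}) : hg_prob p2 p3 P = Pr (@pe n p2 p3) P.
Proof.
rewrite /hg_prob /sumR foldrE big_map big_filter big_enum_cond /=.
apply: eq_bigr => H _.
rewrite /hg_weight /prodR foldrE big_map big_enum /=; case: ifPn => h23.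
  apply: eq_bigr => e _; rewrite /pe; case: ifP => // e2; case: ifP => // e3.
  case: ifP => [eH|_]; last by ring.
  by have := forall_inP h23 e eH; rewrite e2 e3.
case/forall_inPn: h23 => e eH; rewrite negb_or => /andP[/negbTE e2 /negbTE e3].
by rewrite /wt (bigD1 e) //= eH /pe e2 e3 Rmult_0_l.
Qed.

Lemma Pr_sizes23 (P Q : pred {set {set V}}) :
  (forall H, sizes23 H -> P H -> Q H) -> Pr (pe p2 p3) P <= Pr (pe p2 p3) Q.
Proof.
move=> PQ; rewrite -!hg_prob_Pr.
have E (X : pred {set {set V}}) :
    hg_prob p2 p3 X = Pr (pe p2 p3) (fun H => sizes23 H && X H).
  rewrite hg_prob_Pr (Pr_split _ X (fun H => sizes23 H)).
  suff -> : Pr (pe p2 p3) (fun H => ~~ sizes23 H && X H) = 0 by rewrite Rplus_0_r.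
  rewrite -hg_prob_Pr /hg_prob /sumR foldrE big_map big_filter big_enum_cond big1 //.
  by move=> H /andP[_ /andP[/negbTE h _]]; rewrite /hg_weight -/(sizes23 H) h.
rewrite !E; apply: Pr_le; first exact: pe01.
by move=> H /andP[h /(PQ _ h)->]; rewrite h.
Qed.

(** A pair D inside [S] and a vertex w outside give the triple [w |: D], from which D and w are
    recovered by intersecting with [S] and removing [S]. *)
Lemma card_crossing (S : {set V}) :
  ('C(#|S|, 2) * #|~: S| <= #|[set e : {set V} | (#|e| == 3)%N && (#|e :\: S| == 1)%N]|)%N.
Proof.
rewrite -cards_draws -cardsX.
set X := setX _ _.
have pX u : u \in X -> [/\ u.1 \subset S, #|u.1| = 2%N, u.2 \notin S & u.2 \notin u.1].
  rewrite !inE => /andP[/andP[DS /eqP D2] wS]; split => //.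
  by apply: contra wS; apply: (subsetP DS).
have fD u : u \in X -> (u.2 |: u.1) :\: S = [set u.2].
  case/pX=> DS D2 wS wD; apply/setP=> z; rewrite !inE.
  case: (eqVneq z u.2) => [->|_]; first by rewrite wS.
  by rewrite andbC; apply/andP=> -[/(subsetP DS)->].
have fI u : u \in X -> (u.2 |: u.1) :&: S = u.1.
  case/pX=> DS D2 wS wD; apply/setP=> z; rewrite !inE.
  case: (eqVneq z u.2) => [->|_] /=; first by rewrite (negbTE wS) (negbTE wD).
  by rewrite andbC; case: (boolP (z \in u.1)) => [/(subsetP DS)->|]; rewrite ?andbF.
have inj : {in X &, injective (fun u : {set V} * V => u.2 |: u.1)}.
  move=> [D w] [D' w'] uX uX' /= E.
  have := fD _ uX; have := fD _ uX'; rewrite /= E => -> /set1_inj ->.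
  by have := fI _ uX; have := fI _ uX'; rewrite /= E => -> ->.
rewrite -(card_in_imset inj); apply: subset_leq_card; apply/subsetP=> e /imsetP[u uX ->].
rewrite inE (fD u uX) cards1 eqxx andbT; case: (pX u uX) => _ D2 _ wD.
by rewrite cardsU1 wD D2.
Qed.

Lemma Pr_closed (S : {set V}) :
  Pr (pe p2 p3) (fun H => prop_closed H S) <= (1 - p3) ^ ('C(#|S|, 2) * (n - #|S|)).
Proof.
set Q := [set e : {set V} | (#|e| == 3)%N && (#|e :\: S| == 1)%N].
apply: (@Rle_trans _ (Pr (pe p2 p3) (fun H => [disjoint Q & H]))).
  apply: Pr_le; first exact: pe01.
  move=> H /prop_closedP h; rewrite disjoint_subset; apply/subsetP=> e.
  rewrite !inE => /andP[/eqP e3 /eqP eS]; apply/negP=> eH.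
  by apply: (h e eH); rewrite ?e3.
rewrite Pr_avoid (eq_bigr (fun=> 1 - p3)); last first.
  by move=> e; rewrite inE => /andP[/eqP e3 _]; rewrite /pe e3.
rewrite rprod_pow.
have h0 : 0 <= 1 - p3 <= 1 by lra.
have mono a b : (a <= b)%N -> (1 - p3) ^ b <= (1 - p3) ^ a.
  move=> ab; rewrite -(subnK ab) Rdef_pow_add.
  have := pow_incr (1 - p3) 1 (b - a) h0; rewrite pow1 => h1.
  have := pow_le (1 - p3) a (proj1 h0); have := pow_le (1 - p3) (b - a) (proj1 h0); nra.
apply: mono; apply: leq_trans (card_crossing S).
by rewrite [#|~: S|]cardsCs setCK card_ord.
Qed.

Lemma rsum_pow_card (y : R) : \rsum_(S : {set V} | true) y ^ #|S| = (1 + y) ^ n.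
Proof.
have h m : iter m (Rmult (y + 1)) 1 = (y + 1) ^ m by elim: m => //= m ->.
rewrite Rplus_comm -h -big_const_ord.
rewrite bigA_distr; apply: eq_bigr => S _.
rewrite -rprod_pow big_mkcond /=; exact: eq_bigr.
Qed.

(** With this form of the bound the sum over sets factorizes into (1 + y)^n, with no estimate of
    binomial coefficients; the second term is handled by complementation. The conditions [0 < K] and
    [s < n] exclude the empty set from both sums, hence the -1. *)
Lemma Pr_exists_closed (K : nat) (y : R) : (0 < K)%N -> 0 <= y ->
  (forall s, (K <= s < n)%N -> (1 - p3) ^ ('C(s, 2) * (n - s)) <= y ^ s + y ^ (n - s)) ->
  Pr (pe p2 p3) (fun H => [exists S : {set V}, (K <= #|S| < n)%N && prop_closed H S]) <=
  2 * ((1 + y) ^ n - 1).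
Proof.
move=> K0 y0 hy.
apply: Rle_trans (Pr_exists (pe01 p2_01 p3_01) _ _) _.
apply: (@Rle_trans _ (\rsum_(S : {set V} | (K <= #|S| < n)%N) (y ^ #|S| + y ^ #|~: S|))).
  apply: rsum_le => S h; apply: Rle_trans (Pr_closed S) _.
  by rewrite [#|~: S|]cardsCs setCK card_ord; apply: hy.
rewrite big_split /= -Rplus_diag.
have pos (S : {set V}) : 0 <= y ^ #|S| by apply: pow_le.
have ne (P : pred {set V}) : (forall S, P S -> S != set0) ->
    \rsum_(S : {set V} | P S) y ^ #|S| <= (1 + y) ^ n - 1.
  move=> hP; rewrite -rsum_pow_card [X in _ <= X - _](bigD1 set0) //= cards0.
  by rewrite /= Rplus_minus_l; apply: rsum_sub.
apply: Rplus_le_compat.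
  by apply: ne => S /andP[KS _]; rewrite -card_gt0; apply: leq_trans KS.
rewrite (reindex_inj (@setC_inj V)) /=.
rewrite (eq_bigr (fun S : {set V} => y ^ #|S|)); last by move=> S _; rewrite setCK.
apply: ne => S /andP[_ Sn]; apply: contraTneq Sn => ->.
by rewrite setC0 cardsT card_ord ltnn.
Qed.

End ClosedSets.

(** * Bounds for fixed parameters *)

Section Connectivity.
Variables (n : nat) (p2 p3 : R).
Hypotheses (p2_01 : 0 <= p2 <= 1) (p3_01 : 0 <= p3 <= 1).

Lemma prob_connected_le (K : nat) (g : nat -> nat -> R) : (1 < n)%N -> (K <= n)%N ->
  (forall j a, (j <= K)%N -> 0 <= g j a) ->
  (forall a, 1 <= g K a) ->
  (forall j a m, (j < K)%N -> (m <= n)%N ->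
     binomE (hit p2 p3 j) m (fun i => g j.+1 (a + i)%N) 0 <= g j a.+1) ->
  hg_prob p2 p3 (fun H => @prop_connected n H) <= INR n * g 0%N 1%N.
Proof.
move=> n1 Kn g0 g1 gs; rewrite hg_prob_Pr.
pose ex v := explore n n.+1 K (fun _ => pred0) set0 set0 [set v] : pred {set {set 'I_n}}.
apply: (@Rle_trans _ (Pr (pe p2 p3) (fun H => [exists v, true && ex v H]))).
  apply: Pr_sizes23 => // H h23 /(prop_connected_spreads n1 h23)[v sp].
  apply/existsP; exists v; apply/negPn/negP => /explore_complete; case=> //.
  - by rewrite disjoints1 inE.
  - move=> e eH; rewrite setD0 => ->.
    by rewrite ltnn.
  move=> S [cS _ vS]; rewrite cards0 add0n (sp S) //; last by rewrite -sub1set.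
  by rewrite cardsT card_ord ltnNge Kn.
apply: Rle_trans (Pr_exists (pe01 p2_01 p3_01) _ _) _.
apply: (@Rle_trans _ (\rsum_(v : 'I_n | true) g 0%N 1%N)).
  apply: rsum_le => v _.
  have := @explore_le n p2 p3 p2_01 p3_01 n n.+1 K g (ltnSn n) g0 g1 gs K set0 set0 [set v].
  rewrite cards0 cards1; apply => //.
  by rewrite disjoints1 inE.
rewrite big_const_ord; right.
by elim: n => [|m IH]; rewrite ?S_INR /= ?IH; ring.
Qed.

Lemma prob_connected_ge (N K T : nat) (v : nat -> nat -> R) (y : R) :
  (0 < N)%N -> (0 < K)%N -> (N + T * K + K <= n)%N ->
  (forall j a, j = K \/ (K <= a)%N -> v j a <= 1) ->
  (forall j, v j 0%N <= 0) ->
  (forall j a, (j < K)%N -> (a.+1 < K)%N ->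
     v j a.+1 <= binomE (hit p2 p3 j) N (fun i => v j.+1 (a + i)%N) 0) ->
  0 <= y ->
  (forall s, (K <= s < n)%N -> (1 - p3) ^ ('C(s, 2) * (n - s)) <= y ^ s + y ^ (n - s)) ->
  1 - (1 - v 0%N 1%N) ^ T - 2 * ((1 + y) ^ n - 1) <=
  hg_prob p2 p3 (fun H => @prop_connected n H).
Proof.
move=> N0 K0 NTK v1 v0 vs y0 hy; rewrite hg_prob_Pr.
(* With [cap] equal to [K], a trial that stops early has also infected at least [K] vertices. *)
pose tr := trials N K K T set0 : pred {set {set 'I_n}}.
pose cl (H : {set {set 'I_n}}) := [exists S : {set 'I_n}, (K <= #|S| < n)%N && prop_closed H S].
have pe0 := @pe01 n _ _ p2_01 p3_01.
have h1 : 1 - (1 - v 0%N 1%N) ^ T <= Pr (pe p2 p3) tr.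
  apply: trials_ge => //; first by lia.
  by rewrite cards0; lia.
have h2 : Pr (pe p2 p3) cl <= 2 * ((1 + y) ^ n - 1) by apply: Pr_exists_closed.
have h3 : Pr (pe p2 p3) tr <=
    Pr (pe p2 p3) (fun H => @prop_connected n H) + Pr (pe p2 p3) cl.
  apply: Rle_trans; last exact: (Pr_or pe0).
  apply: Pr_le => // H trH.
  case: (boolP (cl H)) => [_|ncl]; first by rewrite orbT.
  rewrite orbF; case: (trials_sound (leqnn K) trH) => w hw.
  apply: (spreads_prop_connected (v := w)) => S wS cS.
  have KS := hw S cS wS; apply/eqP; rewrite eqEcard subsetT cardsT card_ord /=.
  rewrite leqNgt; apply: contra ncl => Sn; apply/existsP; exists S.
  by rewrite KS Sn cS.
have aux (a b c d e : R) : 1 - a <= b -> c <= d -> b <= e + c -> 1 - a - d <= e by lra.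
exact: aux h1 h2 h3.
Qed.

Lemma hit_le j : hit p2 p3 j <= p2 + INR j * p3.
Proof.
suff h : 1 - INR j * p3 <= (1 - p3) ^ j.
  have h0 := pos_INR j; have h1 : 0 <= INR j * p3 by apply: Rmult_le_pos; lra.
  by rewrite /hit; nra.
elim: j => [|j IH]; first by rewrite /=; lra.
rewrite S_INR /=; have h0 := pos_INR j.
have h1 : (1 - p3) * (1 - INR j * p3) <= (1 - p3) * (1 - p3) ^ j.
  by apply: Rmult_le_compat_l => //; lra.
have : 0 <= INR j * p3 * p3 by apply: Rmult_le_pos; [apply: Rmult_le_pos|]; lra.
lra.
Qed.

Lemma one_sub_le_exp x : 1 - x <= exp (- x).
Proof. have := exp_ineq1_le (- x); lra. Qed.

Lemma pow_exp x k : exp x ^ k = exp (INR k * x).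
Proof.
elim: k => [|k IH]; first by rewrite /= Rmult_0_l exp_0.
by rewrite S_INR /= IH -exp_plus; congr exp; ring.
Qed.

Lemma exp_neg_le u : 0 <= u -> exp (- u) <= / (1 + u).
Proof.
move=> u0; rewrite exp_Ropp; apply: Rinv_le_contravar; first lra.
exact: exp_ineq1_le.
Qed.

Lemma hit_ge j : (p2 + INR j * p3) / (1 + (p2 + INR j * p3)) <= hit p2 p3 j.
Proof.
set u := p2 + INR j * p3; have h0 := pos_INR j.
have u0 : 0 <= u by have : 0 <= INR j * p3 by [apply: Rmult_le_pos; lra]; rewrite /u; lra.
have : (1 - p2) * (1 - p3) ^ j <= exp (- u).
  have -> : exp (- u) = exp (- p2) * exp (- p3) ^ j.
    by rewrite pow_exp -exp_plus; congr exp; rewrite /u; ring.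
  apply: Rmult_le_compat; [lra | apply: pow_le; lra | exact: one_sub_le_exp |].
  by apply: pow_incr; split; [lra | exact: one_sub_le_exp].
have := exp_neg_le u0; rewrite /hit.
have -> : u / (1 + u) = 1 - / (1 + u) by field; lra.
lra.
Qed.

End Connectivity.

(* [ent (rate j)] is, up to the factor [ln n / r], an antiderivative of the
   cost [1 - lambda + ln lambda] of step [j]. *)
Definition ent (x : R) : R := x * ln x - x ^ 2 / 2.

Lemma ln_le_sub x : 0 < x -> ln x <= x - 1.
Proof.
move=> x0; have := exp_ineq1_le (ln x); rewrite exp_ln //; lra.
Qed.

Lemma ln_quot x y : 0 < x -> 0 < y -> ln (x / y) = ln x - ln y.
Proof.
by move=> x0 y0; rewrite /Rdiv ln_mult // ?ln_Rinv //; apply: Rinv_0_lt_compat.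
Qed.

(** Taylor expansion with derivative 1 - x + ln x: x ln x is convex, so only the term - x^2 / 2
    contributes an error. *)
Lemma ent_ge l m : 0 < l -> 0 < m ->
  (m - l) * (1 - l + ln l) - (m - l) ^ 2 / 2 <= ent m - ent l.
Proof.
move=> l0 m0.
have h : m - l <= m * (ln m - ln l).
  have := ln_le_sub (Rdiv_lt_0_compat _ _ l0 m0); rewrite ln_quot // => h.
  have : m * (ln l - ln m) <= m * (l / m - 1) by apply: Rmult_le_compat_l; lra.
  have -> : m * (l / m - 1) = l - m by field; lra.
  lra.
rewrite /ent; nra.
Qed.

(** Here the error comes from ln (m / l) <= m / l - 1, and the negative quadratic term is
    dropped. *)
Lemma ent_le l m : 0 < l -> 0 < m ->
  ent m - ent l <= (m - l) * (1 - l + ln l) + (m - l) ^ 2 / l.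
Proof.
move=> l0 m0.
have h : m * (ln m - ln l) <= (m - l) + (m - l) ^ 2 / l.
  have := ln_le_sub (Rdiv_lt_0_compat _ _ m0 l0); rewrite ln_quot // => h.
  have : m * (ln m - ln l) <= m * (m / l - 1) by apply: Rmult_le_compat_l; lra.
  have -> : m * (m / l - 1) = (m - l) + (m - l) ^ 2 / l by field; lra.
  lra.
move: h; rewrite /ent; set Q := (m - l) ^ 2 / l => h.
have := pow2_ge_0 (m - l); nra.
Qed.

Lemma I_er_ent eps r : 0 < r -> eps < 1 -> I_er eps r = (ent 1 - ent (1 - eps)) / r.
Proof. by move=> r0 e1; rewrite /I_er /ent ln_1; field; lra. Qed.

Lemma pow_ge1 x k : 1 <= x -> 1 <= x ^ k.
Proof. by move=> x1; rewrite -(pow1 k); apply: pow_incr; lra. Qed.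

Lemma pow_lower x k : -1 < x -> exp (INR k * (x / (1 + x))) <= (1 + x) ^ k.
Proof.
move=> x1; rewrite -pow_exp; apply: pow_incr; split; first exact: Rlt_le (exp_pos _).
have -> : x / (1 + x) = - (/ (1 + x) - 1) by field; lra.
rewrite exp_Ropp -[X in _ <= X]Rinv_inv; apply: Rinv_le_contravar.
  by apply: Rinv_0_lt_compat; lra.
by have := exp_ineq1_le (/ (1 + x) - 1); lra.
Qed.

(* The ground state of a critical random walk killed outside [(0, M)], up to a
   quadratic approximation; its negative part beyond [M] pays for overshoots. *)
Definition hump (M : nat) (a : nat) : R := INR a * (INR M - INR a).

(** One active vertex is processed, leaving [a], and about one is gained. By concavity the expected
    loss is about the variance 1, and at most 3 with the drift errors; since the hump is at least M
    - 1 at integers strictly between 0 and M, this is a fraction 3 / (M - 1). *)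
Lemma hump_step (M N a : nat) (q : R) : 0 <= q <= 1 -> (4 <= M)%N -> (a.+1 < M)%N ->
  Rabs (INR N * q - 1) <= / INR M ->
  hump M a.+1 * (1 - 3 / (INR M - 1)) <= binomE q N (fun i => hump M (a + i)%N) 0.
Proof.
move=> [q0 q1] M4 aM hs.
have M4' : 4 <= INR M.
  by have := le_INR 4 M; rewrite /=; move=> h; apply: Rle_trans (h _); [lra|lia].
have aM' : INR a + 2 <= INR M.
  have := le_INR a.+2 M; rewrite !S_INR => h; have := h ltac:(lia); lra.
have a0 := pos_INR a.
rewrite (@eq_binomE _ _ _ (fun i => INR a * (INR M - INR a) + (INR M - 2 * INR a) * INR i
  + -1 * INR i ^ 2)); last by move=> i; rewrite /hump plus_INR; ring.
rewrite binomE_quadratic /hump S_INR (_ : INR 0 = 0) //.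
set s := INR N * q in hs *; set A := INR a in a0 aM' *; set m := INR M in hs M4' aM' *.
set d := s - 1 in hs.
have md : m * Rabs d <= 1.
  have : m * Rabs d <= m * / m by apply: Rmult_le_compat_l; lra.
  by rewrite Rinv_r; lra.
have d1 : m * d <= 1 by have := Rle_abs d; nra.
have d2 : - 1 <= m * d by have := Rle_abs (- d); rewrite Rabs_Ropp; nra.
have sE : s = 1 + d by rewrite /d; ring.
have s0 : 0 <= s by rewrite /s; apply: Rmult_le_pos => //; apply: pos_INR.
have h3 : (A + 1) * (m - (A + 1)) * (3 / (m - 1)) >= 3.
  have -> : (A + 1) * (m - (A + 1)) * (3 / (m - 1)) =
     3 + 3 * (A * (m - 2 - A)) / (m - 1) by field; lra.
  have : 0 <= 3 * (A * (m - 2 - A)) / (m - 1).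
    apply: Rmult_le_pos; last by apply/Rlt_le/Rinv_0_lt_compat; lra.
    by have : 0 <= A * (m - 2 - A) by [apply: Rmult_le_pos; lra]; lra.
  lra.
have dd : d ^ 2 <= 1 / 16.
  have h4 : Rabs d <= / 4.
    by apply: Rle_trans hs _; apply: Rinv_le_contravar; lra.
  have h5 : d ^ 2 = Rabs d ^ 2 by rewrite pow2_abs.
  have := Rabs_pos d; rewrite h5; nra.
have sq : 0 <= s * q by apply: Rmult_le_pos.
have cross : - 1 <= (m - 2 * A - 2) * d.
  have [d0|d0] := Rle_or_lt 0 d; nra.
have d4 : d <= / 4.
  by apply: Rle_trans (Rle_abs d) (Rle_trans _ _ _ hs _); apply: Rinv_le_contravar; lra.
have E : A * (m - A) + (m - 2 * A) * (0 + s) + -1 * ((0 + s) ^ 2 + s * (1 - q)) =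
    (A + 1) * (m - (A + 1)) + (- 1 + (m - 2 * A - 2) * d - d - d ^ 2 + s * q).
  by rewrite sE; ring.
rewrite E.
have -> : (A + 1) * (m - (A + 1)) * (1 - 3 / (m - 1)) =
    (A + 1) * (m - (A + 1)) - (A + 1) * (m - (A + 1)) * (3 / (m - 1)) by ring.
lra.
Qed.

(** * The subthreshold case *)

Lemma nat_floor x : 0 <= x -> exists K : nat, INR K <= x < INR K + 1.
Proof.
move=> x0; have [h1 h2] := archimed x.
have u0 : (0 <= up x - 1)%Z.
  have : (0 < up x)%Z by apply: lt_IZR; rewrite /=; lra.
  lia.
have [K E] := IZN _ u0; exists K; rewrite INR_IZR_INZ -E minus_IZR; lra.
Qed.

Lemma exp_mono x y : x <= y -> exp x <= exp y.
Proof. by case=> [/exp_increasing/Rlt_le|->]; lra. Qed.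

Lemma exp_ge_sq x : 0 <= x -> (x / 2) ^ 2 <= exp x.
Proof.
move=> x0; have -> : x = x / 2 + x / 2 by field.
rewrite exp_plus; have := exp_ineq1_le (x / 2).
have -> : ((x / 2 + x / 2) / 2) = x / 2 by field.
nra.
Qed.

Lemma ln_unbounded B : exists n0 : nat, forall n : nat, (n0 <= n)%N -> (0 < n)%N /\ B <= ln (INR n).
Proof.
have [n0 h] := INR_unbounded (exp B); exists n0 => n n0n.
have hn : exp B < INR n by have := le_INR n0 n ltac:(lia); lra.
have B0 := exp_pos B.
split; first by case: n hn {n0n} => //=; lra.
by rewrite -(ln_exp B); apply: Rlt_le; apply: ln_increasing.
Qed.

Definition rate (eps r : R) (n j : nat) : R := 1 - eps + r * INR j / ln (INR n).

Section Rates.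
Variables (eps r : R) (n : nat).
Hypotheses (eps01 : 0 < eps < 1) (r0 : 0 < r) (n0 : (0 < n)%N) (L0 : 0 < ln (INR n)).
Local Notation L := (ln (INR n)).
Local Notation lam := (rate eps r n).

Lemma INR_pos : 0 < INR n.
Proof. by apply: lt_0_INR; lia. Qed.

Lemma exp_lnn : exp L = INR n.
Proof. exact: exp_ln INR_pos. Qed.

Lemma rateS j : lam j.+1 - lam j = r / L.
Proof. by rewrite /rate S_INR; field; lra. Qed.

Lemma rate0 : lam 0 = 1 - eps.
Proof. by rewrite /rate /=; field; lra. Qed.

Lemma rate_mono i j : (i <= j)%N -> lam i <= lam j.
Proof.
move=> ij; rewrite /rate; apply: Rplus_le_compat_l; apply: Rmult_le_compat_r.
  by apply/Rlt_le/Rinv_0_lt_compat.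
by apply: Rmult_le_compat_l; [lra | apply: le_INR; lia].
Qed.

Lemma rate_ge j : 1 - eps <= lam j.
Proof. by rewrite -rate0; apply: rate_mono. Qed.

Lemma mean_rate j : INR n * (p2_of eps n + INR j * p3_of r n) = lam j.
Proof. by have := INR_pos; rewrite /p2_of /p3_of /rate => h; field; lra. Qed.

Lemma p2_of01 : 0 <= p2_of eps n <= 1.
Proof.
have n1 : 1 <= INR n by have := le_INR 1 n; rewrite /=; move=> h; apply: h; lia.
split; first by apply: Rle_mult_inv_pos; lra.
by apply: (Rmult_le_reg_r (INR n)); [lra | rewrite /p2_of; field_simplify; lra].
Qed.

Lemma p3_of01 : 1 <= L -> r <= L -> 0 <= p3_of r n <= 1.
Proof.
clear eps01 => L1 rL; have h := INR_pos; have hL := exp_ineq1_le L; rewrite exp_lnn in hL.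
have nL : 0 < INR n * L by apply: Rmult_lt_0_compat.
split; first by apply: Rle_mult_inv_pos; lra.
apply: (Rmult_le_reg_r (INR n * L)) => //.
have -> : p3_of r n * (INR n * L) = r by rewrite /p3_of; field; lra.
by nra.
Qed.

(** The condition on [K] keeps the rates at most 1, so the weights (1 / lambda)^a are at least 1, as
    the terminal condition requires. *)
Lemma prob_connected_rate_le K : 1 <= L -> r <= L -> (1 < n)%N -> (K <= n)%N ->
  r * INR K <= eps * L ->
  hg_prob (p2_of eps n) (p3_of r n) (fun H => @prop_connected n H) <=
  INR n * (exp (L / r * (ent (lam K) - ent (1 - eps)) + INR K * (r / L / 2)) * / (1 - eps)).
Proof.
move=> L1 rL n1 Kn KL.
have lamK : lam K <= 1.
  have : r * INR K / L <= eps * L / L by apply: Rmult_le_compat_r; [apply/Rlt_le/Rinv_0_lt_compat|].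
  have -> : eps * L / L = eps by field; lra.
  by rewrite /rate; lra.
have pos j : 0 < lam j by have := rate_ge j; lra.
(* The summand [r / L / 2] per step pays for the second-order error of [ent_ge], multiplied by L /
   r. *)
pose C j := exp (L / r * (ent (lam K) - ent (lam j)) + (INR K - INR j) * (r / L / 2)).
pose g j a := C j * (/ lam j) ^ a.
have -> : exp (L / r * (ent (lam K) - ent (1 - eps)) + INR K * (r / L / 2)) * / (1 - eps) =
    g 0%N 1%N.
  by rewrite /g /C rate0 (_ : INR 0 = 0) // Rminus_0_r pow_1.
apply: (@prob_connected_le _ _ _ p2_of01 (p3_of01 L1 rL) K g) => //.
- move=> j a _; apply: Rmult_le_pos; first exact/Rlt_le/exp_pos.
  by apply/pow_le/Rlt_le/Rinv_0_lt_compat.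
- move=> a; rewrite /g /C !Rminus_diag Rmult_0_r Rmult_0_l Rplus_0_l exp_0 Rmult_1_l.
  apply: pow_ge1; rewrite -[X in X <= _]Rinv_1; apply: Rinv_le_contravar => //.
move=> j a m jK mn.
set h := hit _ _ j.
have [h0 h1] : 0 <= h <= 1 by apply: hit01; [exact: p2_of01 | exact: p3_of01].
rewrite (@eq_binomE _ _ _ (fun i => C j.+1 * (/ lam j.+1) ^ a * (/ lam j.+1) ^ i)); last first.
  by move=> i; rewrite /g Rdef_pow_add; ring.
rewrite binomE_scale binomE_pow /= Rmult_1_l.
have lj : lam j <= lam j.+1 by apply: rate_mono.
have lj1 : lam j.+1 <= 1 by apply: Rle_trans lamK; apply: rate_mono.
have z1 : 1 <= / lam j.+1.
  by rewrite -[X in X <= _]Rinv_1; apply: Rinv_le_contravar => //.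
have zz : / lam j.+1 <= / lam j by apply: Rinv_le_contravar.
have hn : INR m * h <= lam j.
  rewrite -mean_rate; apply: Rmult_le_compat => //; first exact: pos_INR.
    by apply: le_INR; lia.
  by apply: hit_le; [exact: p2_of01 | exact: p3_of01].
(* A binomial generating function is at most exp (mean * (z - 1)); the mean is at most lambda_j and
   z at most 1 / lambda_j. *)
have E1 : (1 + h * (/ lam j.+1 - 1)) ^ m <= exp (1 - lam j).
  apply: (@Rle_trans _ (exp (h * (/ lam j.+1 - 1)) ^ m)).
    by apply: pow_incr; split; [nra | exact: exp_ineq1_le].
  rewrite pow_exp; apply: exp_mono.
  apply: (@Rle_trans _ (lam j * (/ lam j - 1))).
    rewrite -Rmult_assoc; apply: Rmult_le_compat => //; try lra.
    by apply: Rmult_le_pos => //; exact: pos_INR.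
  by right; field; have := pos j; lra.
have E2 : (/ lam j.+1) ^ a <= (/ lam j) ^ a by apply: pow_incr; lra.
have E3 : C j.+1 * exp (1 - lam j) <= C j * / lam j.
  have -> : / lam j = exp (- ln (lam j)) by rewrite exp_Ropp exp_ln.
  rewrite /C -!exp_plus; apply: exp_mono; rewrite S_INR.
  have := ent_ge (pos j) (pos j.+1); rewrite rateS => hG.
  have : L / r * (r / L * (1 - lam j + ln (lam j)) - (r / L) ^ 2 / 2) <=
         L / r * (ent (lam j.+1) - ent (lam j)).
    by apply: Rmult_le_compat_l => //; apply/Rlt_le/Rdiv_lt_0_compat.
  have -> : L / r * (r / L * (1 - lam j + ln (lam j)) - (r / L) ^ 2 / 2) =
     1 - lam j + ln (lam j) - r / L / 2 by field; lra.
  rewrite !Rmult_minus_distr_l; lra.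
have Cp k : 0 <= C k by exact/Rlt_le/exp_pos.
have P1 : 0 <= (/ lam j) ^ a by apply/pow_le/Rlt_le/Rinv_0_lt_compat.
have P2 : 0 <= (/ lam j.+1) ^ a by apply/pow_le/Rlt_le/Rinv_0_lt_compat.
apply: (@Rle_trans _ (C j.+1 * (/ lam j) ^ a * exp (1 - lam j))).
  apply: Rmult_le_compat => //; [exact: Rmult_le_pos | by apply: pow_le; nra |].
  exact: Rmult_le_compat_l.
rewrite /g /= (_ : C j.+1 * (/ lam j) ^ a * exp (1 - lam j) =
  C j.+1 * exp (1 - lam j) * (/ lam j) ^ a); last by ring.
rewrite (_ : C j * (/ lam j * (/ lam j) ^ a) = C j * / lam j * (/ lam j) ^ a); last by ring.
exact: Rmult_le_compat_r.
Qed.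

End Rates.

Lemma prob_connected_to0 eps r : 0 < eps < 1 -> 0 < r -> I_er eps r < -1 ->
  forall d, 0 < d -> exists B, forall n, (0 < n)%N -> B <= ln (INR n) ->
  hg_prob (p2_of eps n) (p3_of r n) (fun H => @prop_connected n H) <= d.
Proof.
move=> eps01 r0 I1 d d0.
set I := I_er eps r in I1.
have d1 : 0 < d * (1 - eps) by apply: Rmult_lt_0_compat; lra.
(* The bound 4 / r ensures [K <= n]. The last term makes n exp (I L + 2) at most d (1 - eps), where
   2 covers the error terms [b1] and [b2]. *)
pose B := Rmax (Rmax 1 r) (Rmax (4 / r) ((2 - ln (d * (1 - eps))) / (- 1 - I))).
exists B => n n0 BL; set L := ln (INR n) in BL.
have [] : [/\ 1 <= L, r <= L, 4 / r <= L & (2 - ln (d * (1 - eps))) / (- 1 - I) <= L].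
  have := Rmax_l (Rmax 1 r) (Rmax (4 / r) ((2 - ln (d * (1 - eps))) / (- 1 - I))).
  have := Rmax_r (Rmax 1 r) (Rmax (4 / r) ((2 - ln (d * (1 - eps))) / (- 1 - I))).
  have := Rmax_l 1 r; have := Rmax_r 1 r.
  have := Rmax_l (4 / r) ((2 - ln (d * (1 - eps))) / (- 1 - I)).
  have := Rmax_r (4 / r) ((2 - ln (d * (1 - eps))) / (- 1 - I)).
  by rewrite -/B; split; lra.
move=> L1 rL L4 LI.
have L0 : 0 < L by lra.
have En : exp L = INR n by apply: exp_lnn.
have [K [K1 K2]] : exists K, INR K <= eps * L / r < INR K + 1.
  by apply: nat_floor; apply: Rle_mult_inv_pos => //; nra.
have K1' : r * INR K <= eps * L.
  have -> : eps * L = r * (eps * L / r) by field; lra.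
  by apply: Rmult_le_compat_l; lra.
have K2' : eps * L < r * INR K + r.
  have -> : eps * L = r * (eps * L / r) by field; lra.
  by nra.
have n1 : (1 < n)%N.
  case: n n0 @L BL L1 rL L4 LI L0 En K1 K2 K1' K2' => [|[|n]] //= _ ? _.
  by rewrite ln_1; lra.
have Kn : (K <= n)%N.
  have : INR K <= INR n.
    rewrite -En; apply: Rle_trans (exp_ge_sq _); last lra.
    apply: (Rmult_le_reg_l r) => //; apply: Rle_trans K1' _.
    have : 4 <= r * L by have -> : 4 = r * (4 / r) by [field; lra]; apply: Rmult_le_compat_l; lra.
    nra.
  by move/INR_le; lia.
apply: Rle_trans (prob_connected_rate_le _ _ _ _ _ _ _ _ K1') _ => //.
set x := rate eps r n K.
have x0 : 0 < x by have : 1 - eps <= x by [apply: rate_ge]; lra.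
have xE : x = 1 - eps + r * INR K / L by [].
have xl : (x - 1) ^ 2 <= (r / L) ^ 2.
  have e1 : x <= 1.
    rewrite xE; suff : r * INR K / L <= eps by lra.
    apply: (Rmult_le_reg_r L) => //.
    by have -> : r * INR K / L * L = r * INR K by [field; lra]; lra.
  have e2 : 1 - x <= r / L.
    rewrite xE; apply: (Rmult_le_reg_r L) => //.
    have -> : r / L * L = r by field; lra.
    have -> : (1 - (1 - eps + r * INR K / L)) * L = eps * L - r * INR K by field; lra.
    lra.
  have -> : (x - 1) ^ 2 = (1 - x) ^ 2 by ring.
  by apply: pow_incr; lra.
(* The derivative of [ent] vanishes at 1, so rounding [K] costs only a second-order term. *)
have hx : ent x - ent 1 <= (r / L) ^ 2.
  have := ent_le Rlt_0_1 x0; rewrite ln_1; lra.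
have IE : L / r * (ent x - ent (1 - eps)) = L * I + L / r * (ent x - ent 1).
  by rewrite /I I_er_ent; [field; lra | lra | lra].
have b1 : L / r * (ent x - ent 1) <= 1.
  apply: (@Rle_trans _ (L / r * (r / L) ^ 2)).
    by apply: Rmult_le_compat_l => //; apply/Rlt_le/Rdiv_lt_0_compat.
  have -> : L / r * (r / L) ^ 2 = r / L by field; lra.
  by apply: (Rmult_le_reg_r L) => //; have -> : r / L * L = r by [field; lra]; lra.
have b2 : INR K * (r / L / 2) <= 1.
  apply: (Rmult_le_reg_r L) => //.
  have -> : INR K * (r / L / 2) * L = r * INR K / 2 by field; lra.
  by nra.
rewrite -/L IE -{1}En -Rmult_assoc -exp_plus.
apply: (Rmult_le_reg_r (1 - eps)); first lra.
rewrite Rmult_assoc Rinv_l; last lra.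
rewrite Rmult_1_r -{1}(exp_ln _ d1); apply: exp_mono.
have : 2 - ln (d * (1 - eps)) <= L * (- 1 - I).
  have -> : 2 - ln (d * (1 - eps)) = (2 - ln (d * (1 - eps))) / (- 1 - I) * (- 1 - I) by field; lra.
  by apply: Rmult_le_compat_r; lra.
lra.
Qed.

(** * The superthreshold case *)

Lemma hump_ge0 M a : (a <= M)%N -> 0 <= hump M a.
Proof.
move=> aM; have h : INR a <= INR M by apply: le_INR; lia.
by apply: Rmult_le_pos; [exact: pos_INR | lra].
Qed.

Lemma hump_le0 M a : (M <= a)%N -> hump M a <= 0.
Proof.
move=> aM; have h : INR M <= INR a by apply: le_INR; lia.
by rewrite /hump; have := pos_INR a; nra.
Qed.

Lemma hump_le_sq M a : hump M a <= INR M ^ 2.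
Proof.
rewrite /hump; have := pow2_ge_0 (INR a); have := pow2_ge_0 (INR M - INR a).
by have := pow2_ge_0 (INR M); nra.
Qed.

(** The tilt by 1 / l brings the mean within 1 / M of 1, where [hump_step] applies. The normalizing
    factor is at least exp (mean * (1 - l)) for the tilted mean, which produces the loss 1 / M in
    the exponent. *)
Lemma hump_tilt (M N a : nat) (q l : R) :
  0 <= q <= 1 -> 0 < l -> Rabs (1 - l) <= 1 -> (4 <= M)%N -> (a.+1 < M)%N ->
  0 < 1 + q * (/ l - 1) ->
  Rabs (INR N * (q * / l / (1 + q * (/ l - 1))) - 1) <= / INR M ->
  (/ l) ^ a * (exp (1 - l - / INR M) * (hump M a.+1 * (1 - 3 / (INR M - 1)))) <=
  binomE q N (fun i => (/ l) ^ (a + i) * hump M (a + i)) 0.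
Proof.
move=> q01 l0 l2 M4 aM; set B := 1 + q * (/ l - 1) => B0; set q' := q * / l / B => hs.
have z0 : 0 < / l by apply: Rinv_0_lt_compat.
rewrite (@eq_binomE _ _ _ (fun i => (/ l) ^ a * ((/ l) ^ i * hump M (a + i)))); last first.
  by move=> i; rewrite Rdef_pow_add; ring.
rewrite binomE_scale; apply: Rmult_le_compat_l; first by apply/pow_le/Rlt_le.
rewrite binomE_tilt; last by rewrite -/B; lra.
rewrite -/B -/q' pow_O Rmult_1_l.
have q'01 : 0 <= q' <= 1.
  case: q01 => q0 q1; split; first by apply: Rle_mult_inv_pos => //; apply: Rmult_le_pos => //; lra.
  apply: (Rmult_le_reg_r B) => //; rewrite /q' Rmult_1_l.
  have -> : q * / l / B * B = q * / l by field; lra.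
  by rewrite /B; lra.
have M4' : 4 <= INR M.
  by have := le_INR 4 M; rewrite /=; move=> h; apply: Rle_trans (h _); [lra|lia].
apply: Rmult_le_compat; [exact/Rlt_le/exp_pos | | | exact: hump_step].
  apply: Rmult_le_pos; first by apply: hump_ge0; lia.
  suff : 3 / (INR M - 1) <= 1 by lra.
  by apply: (Rmult_le_reg_r (INR M - 1)); [lra | field_simplify; lra].
apply: Rle_trans (pow_lower _ _); last by rewrite /B in B0; lra.
apply: exp_mono; rewrite -/B.
have -> : INR N * (q * (/ l - 1) / B) = (INR N * q') * (1 - l) by rewrite /q'; field; lra.
have -> : INR N * q' * (1 - l) = (1 - l) + (INR N * q' - 1) * (1 - l) by ring.
have : Rabs ((INR N * q' - 1) * (1 - l)) <= / INR M * 1.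
  by rewrite Rabs_mult; apply: Rmult_le_compat => //; exact: Rabs_pos.
by have := Rle_abs (- ((INR N * q' - 1) * (1 - l))); rewrite Rabs_Ropp; lra.
Qed.

(* [l ^ M * l ^ (- b)] is increasing in [l] exactly where the hump is nonnegative. *)
Lemma hump_weight_mono (M b : nat) (l l' : R) : 0 < l -> l <= l' ->
  l ^ M * ((/ l) ^ b * hump M b) <= l' ^ M * ((/ l') ^ b * hump M b).
Proof.
move=> l0 ll'; have l0' : 0 < l' by lra.
have [bM|/ltnW Mb] := leqP b M.
  have E x : 0 < x -> x ^ M * ((/ x) ^ b * hump M b) = x ^ (M - b) * hump M b.
    move=> x0; rewrite -{1}(subnK bM) Rdef_pow_add pow_inv; field.
    by apply: pow_nonzero; lra.
  rewrite !E //; apply: Rmult_le_compat_r; first exact: hump_ge0.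
  by apply: pow_incr; lra.
have E x : 0 < x -> x ^ M * ((/ x) ^ b * hump M b) = (/ x) ^ (b - M) * hump M b.
  move=> x0; rewrite -{1}(subnK Mb) Rdef_pow_add !pow_inv; field.
  by split; apply: pow_nonzero; lra.
rewrite !E //; have := hump_le0 Mb.
have : (/ l') ^ (b - M) <= (/ l) ^ (b - M).
  by apply: pow_incr; split; [exact/Rlt_le/Rinv_0_lt_compat | exact: Rinv_le_contravar].
by set x := _ ^ _; set y := _ ^ _; set h := hump _ _; nra.
Qed.

(** For X binomial with mean at least La, the expectation of La^(-X) is at most exp (1 - La), hence
    at most 1 / La. *)
Lemma supercritical_step (N a : nat) (q La : R) : 0 <= q <= 1 -> 1 < La -> La <= INR N * q ->
  1 - (/ La) ^ a.+1 <= binomE q N (fun i => 1 - (/ La) ^ (a + i)) 0.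
Proof.
move=> q01 La1 hN.
have r0 : 0 < / La by apply: Rinv_0_lt_compat; lra.
have r1 : / La < 1 by rewrite -Rinv_1; apply: Rinv_lt_contravar; lra.
rewrite (@eq_binomE _ _ _ (fun i => 1 + (- (/ La) ^ a) * (/ La) ^ i)); last first.
  by move=> i; rewrite Rdef_pow_add; ring.
rewrite binomE_affine binomE_pow pow_O Rmult_1_l /=.
suff h : (1 + q * (/ La - 1)) ^ N <= / La.
  have := pow_le (/ La) a (Rlt_le _ _ r0); set x := _ ^ a; set y := _ ^ N in h *; nra.
apply: (@Rle_trans _ (exp (q * (/ La - 1)) ^ N)).
  by apply: pow_incr; split; [nra | exact: exp_ineq1_le].
rewrite pow_exp; apply: (@Rle_trans _ (exp (- (La - 1)))).
  apply: exp_mono.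
  have -> : - (La - 1) = La * (/ La - 1) by field; lra.
  rewrite -Rmult_assoc; nra.
have := @exp_neg_le (La - 1); rewrite (_ : 1 + (La - 1) = La); last by ring.
by apply; lra.
Qed.

(** * The subsolution for the survival probability *)

Section SurvivalValue.
Variables (eps r : R) (n N K K1 M : nat) (th La : R).
Hypotheses (eps01 : 0 < eps < 1) (r0 : 0 < r) (n0 : (0 < n)%N) (L1 : 1 <= ln (INR n))
  (rL : r <= ln (INR n)).
Local Notation L := (ln (INR n)).
Local Notation lam := (rate eps r n).
Local Notation q := (hit (p2_of eps n) (p3_of r n)).
Hypotheses (M4 : (4 <= M)%N) (MK : (M <= K)%N) (K1K : (K1 <= K)%N) (K1_gt0 : (0 < K1)%N)
  (La1 : 1 < La).
Hypothesis hth : exp (- th) <= exp (- / INR M) * (1 - 3 / (INR M - 1)).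
Hypothesis lamK1 : 1 <= lam K1 <= 2.
Hypothesis critical : forall j, (j < K1)%N ->
  0 < 1 + q j * (/ lam j - 1) /\
  Rabs (INR N * (q j * / lam j / (1 + q j * (/ lam j - 1))) - 1) <= / INR M.
Hypothesis supercritical : forall j, (K1 <= j < K)%N -> La <= INR N * q j.

(** Chosen for the gluing at step [K1]: with lambda^M at most 2^M and the hump at most M^2, the
    subcritical value lies below 1 - La^(-a) for every a >= 1. *)
Definition value_cst : R := (1 - / La) / (2 ^ M * INR M ^ 2).

(** Per step, [th] pays for the losses of the hump and of the tilt, and [r / L / (1 - eps)] for the
    error of [ent_le]. *)
Definition value_coef (j : nat) : R :=
  exp (L / r * (ent (lam K1) - ent (lam j)) - (INR K1 - INR j) * (th + r / L / (1 - eps))).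

(** The factor [lam j ^ M] makes the weight monotone in the rate whatever the sign of the hump, so
    the tilt may use lambda_j although the next value involves lambda_(j+1). *)
Definition subcritical_value (j a : nat) : R :=
  value_cst * value_coef j * (lam j ^ M * ((/ lam j) ^ a * hump M a)).

Definition value (j a : nat) : R :=
  if (j < K1)%N then Rmax 0 (subcritical_value j a) else 1 - (/ La) ^ a.

Let L0 : 0 < L. Proof. lra. Qed.

Let q01 j : 0 <= q j <= 1.
Proof. by apply: hit01; [apply: p2_of01 | apply: p3_of01]. Qed.

Let lam_gt0 j : 0 < lam j.
Proof. have : 1 - eps <= lam j by [apply: rate_ge]; lra. Qed.

Let La_inv : 0 < / La < 1.
Proof.
split; first by apply: Rinv_0_lt_compat; lra.
by rewrite -Rinv_1; apply: Rinv_lt_contravar; lra.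
Qed.

Let M_ge4 : 4 <= INR M.
Proof. have := le_INR 4 M; rewrite /=; move=> h; apply: Rle_trans (h _); [lra|lia]. Qed.

Let cst_gt0 : 0 < value_cst.
Proof.
apply: Rdiv_lt_0_compat; first lra.
by apply: Rmult_lt_0_compat; apply: pow_lt; lra.
Qed.

Lemma subcritical_le0 j a : (M <= a)%N -> subcritical_value j a <= 0.
Proof.
move=> /hump_le0 h.
have c0 : 0 < value_coef j by exact: exp_pos.
have p1 := pow_lt _ M (lam_gt0 j).
have p2 := pow_lt _ a (Rinv_0_lt_compat _ (lam_gt0 j)).
rewrite /subcritical_value.
have h1 : 0 < value_cst * value_coef j by apply: Rmult_lt_0_compat.
have h2 : (/ lam j) ^ a * hump M a <= 0 by set x := _ ^ a in p2 *; nra.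
have h3 : lam j ^ M * ((/ lam j) ^ a * hump M a) <= 0.
  by set x := _ * hump _ _ in h2 *; nra.
by set x := _ ^ M * _ in h3 *; nra.
Qed.

Lemma value_le1 j a : j = K \/ (K <= a)%N -> value j a <= 1.
Proof.
rewrite /value; case: ltnP => [jK1 [jK|Ka]|_ _].
- by move: jK1; rewrite jK ltnNge K1K.
- by rewrite Rmax_left; [lra | apply: subcritical_le0; apply: leq_trans Ka].
by have : 0 <= (/ La) ^ a by [apply: pow_le; lra]; lra.
Qed.

Lemma value_at0 j : value j 0 <= 0.
Proof.
rewrite /value; case: ifP => _; last by rewrite pow_O; lra.
by rewrite /subcritical_value /hump /= Rmult_0_l !Rmult_0_r Rmax_left; lra.
Qed.

Lemma value_ge0 j a : 0 <= value j a.
Proof.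
rewrite /value; case: ifP => _; first exact: Rmax_l.
suff : (/ La) ^ a <= 1 by lra.
by rewrite -(pow1 a); apply: pow_incr; lra.
Qed.

Lemma subcritical_le_value j a : (j <= K1)%N -> subcritical_value j a <= value j a.
Proof.
rewrite /value leq_eqVlt => /orP[/eqP->|->]; last exact: Rmax_r.
rewrite ltnn /subcritical_value /value_coef !Rminus_diag Rmult_0_r Rmult_0_l.
rewrite Rminus_0_r exp_0 Rmult_1_r.
have l1 := lamK1; have z1 : / lam K1 <= 1.
  by rewrite -Rinv_1; apply: Rinv_le_contravar; lra.
have z0 : 0 <= / lam K1 by apply/Rlt_le/Rinv_0_lt_compat; lra.
have za : (/ lam K1) ^ a <= 1 by rewrite -(pow1 a); apply: pow_incr; lra.
have za0 : 0 <= (/ lam K1) ^ a by apply: pow_le.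
have lM : lam K1 ^ M <= 2 ^ M by apply: pow_incr; lra.
have lM0 : 0 < lam K1 ^ M by apply: pow_lt; lra.
have M2 : 0 < INR M ^ 2 by apply: pow_lt; lra.
have M2' : 0 < 2 ^ M by apply: pow_lt; lra.
case: a za za0 => [|a] za za0.
  by rewrite /hump /= Rmult_0_l !Rmult_0_r; lra.
apply: (@Rle_trans _ (1 - / La)); last first.
  have : (/ La) ^ a <= 1 by rewrite -(pow1 a); apply: pow_incr; lra.
  by rewrite /=; set x := _ ^ a; nra.
have -> : 1 - / La = value_cst * (2 ^ M * INR M ^ 2) by rewrite /value_cst; field; lra.
apply: Rmult_le_compat_l; first lra.
apply: (@Rle_trans _ (lam K1 ^ M * INR M ^ 2)); last by apply: Rmult_le_compat_r; lra.
apply: Rmult_le_compat_l; first lra.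
have := hump_le_sq M a.+1; set h := hump _ _; set z := _ ^ a.+1 in za za0 *.
by move=> hh; have [h0|h0] := Rle_or_lt 0 h; nra.
Qed.

Lemma value_step j a : (j < K)%N -> (a.+1 < K)%N ->
  value j a.+1 <= binomE (q j) N (fun i => value j.+1 (a + i)%N) 0.
Proof.
move=> jK aK; rewrite {1}/value; case: ltnP => [jK1|K1j]; last first.
  rewrite (@eq_binomE _ _ _ (fun i => 1 - (/ La) ^ (a + i))); last first.
    by move=> i; rewrite /value ltnNge (leqW K1j).
  by apply: supercritical_step => //; apply: supercritical; rewrite K1j.
apply: Rmax_lub.
  by apply: binomE_ge0 => // i; exact: value_ge0.
have [aM|Ma] := ltnP a.+1 M; last first.
  apply: (@Rle_trans _ 0).
    exact: subcritical_le0.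
  by apply: binomE_ge0 => // i; exact: value_ge0.
have lS : lam j <= lam j.+1 by apply: rate_mono.
have c0 : 0 < value_coef j.+1 by exact: exp_pos.
have p1 := pow_lt _ M (lam_gt0 j).
have p2 := pow_lt _ a (Rinv_0_lt_compat _ (lam_gt0 j)).
apply: (@Rle_trans _ (binomE (q j) N (fun i => value_cst * value_coef j.+1 * lam j ^ M *
    ((/ lam j) ^ (a + i) * hump M (a + i))) 0)); last first.
  apply: binomE_le => // i; apply: Rle_trans (subcritical_le_value _ jK1).
  rewrite Rmult_assoc; apply: Rmult_le_compat_l; first by apply: Rmult_le_pos; lra.
  exact: hump_weight_mono.
rewrite binomE_scale.
have [B0 hs] := critical jK1.
have l2 : Rabs (1 - lam j) <= 1.
  have : 1 - eps <= lam j by apply: rate_ge.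
  have : lam j <= lam K1 by apply: rate_mono => //; apply: ltnW.
  by move=> *; apply: Rabs_le; lra.
have tilt := hump_tilt (q01 j) (lam_gt0 j) l2 M4 aM B0 hs.
apply: Rle_trans (Rmult_le_compat_l _ _ _ _ tilt); last first.
  by apply/Rlt_le; do 2 (apply: Rmult_lt_0_compat => //).
have coef : value_coef j * / lam j <=
    value_coef j.+1 * (exp (1 - lam j - / INR M) * (1 - 3 / (INR M - 1))).
  have -> : exp (1 - lam j - / INR M) = exp (1 - lam j) * exp (- / INR M).
    by rewrite -exp_plus.
  rewrite Rmult_assoc -Rmult_assoc.
  apply: (@Rle_trans _ (value_coef j.+1 * exp (1 - lam j) * exp (- th))); last first.
    apply: Rmult_le_compat_l => //.
    by apply: Rmult_le_pos; [lra | exact/Rlt_le/exp_pos].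
  have -> : / lam j = exp (- ln (lam j)) by rewrite exp_Ropp exp_ln.
  rewrite /value_coef -!exp_plus; apply: exp_mono; rewrite S_INR.
  have := ent_le (lam_gt0 j) (lam_gt0 j.+1); rewrite rateS // => hG.
  have h1 : (r / L) ^ 2 / lam j <= (r / L) ^ 2 / (1 - eps).
    apply: Rmult_le_compat_l; first exact: pow2_ge_0.
    by apply: Rinv_le_contravar; [lra | apply: rate_ge].
  have h2 : L / r * (ent (lam j.+1) - ent (lam j)) <=
      L / r * (r / L * (1 - lam j + ln (lam j)) + (r / L) ^ 2 / (1 - eps)).
    by apply: Rmult_le_compat_l; [apply/Rlt_le/Rdiv_lt_0_compat | lra].
  have E : L / r * (r / L * (1 - lam j + ln (lam j)) + (r / L) ^ 2 / (1 - eps)) =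
     1 - lam j + ln (lam j) + r / L / (1 - eps) by field; lra.
  rewrite E in h2; rewrite !Rmult_minus_distr_l in h2 *; lra.
have hp : 0 < hump M a.+1.
  rewrite /hump; apply: Rmult_lt_0_compat; first by apply: lt_0_INR; lia.
  by have : INR a.+1 < INR M by [apply: lt_INR; lia]; lra.
rewrite /subcritical_value /= .
set h := hump M a.+1 in hp *; set z := (/ lam j) ^ a in p2 *; set w := lam j ^ M in p1 *.
have -> : value_cst * value_coef j * (w * (/ lam j * z * h)) =
  value_cst * w * z * h * (value_coef j * / lam j) by ring.
set e := exp _ in coef *; set y := 1 - _ in coef *.
have -> : value_cst * value_coef j.+1 * w * (z * (e * (h * y))) =
  value_cst * w * z * h * (value_coef j.+1 * (e * y)) by ring.
by apply: Rmult_le_compat_l => //; apply/Rlt_le; do 3 (apply: Rmult_lt_0_compat => //).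
Qed.

Lemma value_start :
  value_cst * (1 - eps) ^ M *
    exp (L / r * (ent (lam K1) - ent (1 - eps)) - INR K1 * (th + r / L / (1 - eps))) <=
  value 0 1.
Proof.
apply: Rle_trans (subcritical_le_value _ (leq0n _)).
rewrite /subcritical_value /value_coef rate0 // (_ : INR 0 = 0) // Rminus_0_r.
set e := exp _; have e0 : 0 < e by exact: exp_pos.
have p1 : 0 < (1 - eps) ^ M by apply: pow_lt; lra.
have : 1 <= (/ (1 - eps)) ^ 1 * hump M 1.
  rewrite pow_1 /hump (_ : INR 1 = 1) // Rmult_1_l.
  have : 1 <= / (1 - eps) by rewrite -[X in X <= _]Rinv_1; apply: Rinv_le_contravar; lra.
  by have := M_ge4; set z := / _; nra.
set x := _ * hump _ _ => x1.
have -> : value_cst * (1 - eps) ^ M * e = value_cst * e * ((1 - eps) ^ M * 1) by ring.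
apply: Rmult_le_compat_l; first by apply: Rmult_le_pos; lra.
by apply: Rmult_le_compat_l; lra.
Qed.

End SurvivalValue.

(** * Estimates for closed sets and for repeated trials *)

Lemma INR_bin2 s : INR 'C(s, 2) = INR s * (INR s - 1) / 2.
Proof.
elim: s => [|s IH]; first by rewrite bin0n /=; field.
by rewrite binS bin1 plus_INR IH S_INR; field.
Qed.

(** Split at s = n / 2, bounding n - s below by n / 2 in one case and s by n / 2 in the other. The
    constant 8 yields the exponent 2 L s, respectively 2 L (n - s), so that y is n^(-2). *)
Lemma crossing_bound (r : R) (n K : nat) : 0 < r -> (0 < n)%N -> 1 <= ln (INR n) ->
  r <= ln (INR n) ->
  8 * ln (INR n) ^ 2 / r + 1 <= INR K ->
  forall s, (K <= s < n)%N ->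
  (1 - p3_of r n) ^ ('C(s, 2) * (n - s)) <=
  exp (- 2 * ln (INR n)) ^ s + exp (- 2 * ln (INR n)) ^ (n - s).
Proof.
move=> r0 n0; set L := ln (INR n) => L1 rL hK s /andP[Ks sn].
have [p0 p1] : 0 <= p3_of r n <= 1 by apply: p3_of01; rewrite -/L //; lra.
have Ks' : INR K <= INR s by apply: le_INR; lia.
have Es : INR (n - s) = INR n - INR s by rewrite minus_INR //; lia.
have np : 0 < INR n by apply: lt_0_INR; lia.
have sn' : INR s <= INR n by apply: le_INR; lia.
apply: (@Rle_trans _ (exp (- p3_of r n) ^ ('C(s, 2) * (n - s)))).
  by apply: pow_incr; split; [lra | exact: one_sub_le_exp].
rewrite !pow_exp mult_INR INR_bin2 Es.
have LL : 0 < 8 * L ^ 2 / r.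
  by apply: Rdiv_lt_0_compat => //; have := pow_lt L 2; nra.
have s1 : 8 * L ^ 2 / r <= INR s - 1 by lra.
set S := INR s in s1 Ks' sn' Es *; set n' := INR n in np Es sn' *.
have pE : p3_of r n = r / (n' * L) by [].
have key : r * (S - 1) >= 8 * L ^ 2.
  have : r * (8 * L ^ 2 / r) <= r * (S - 1) by apply: Rmult_le_compat_l; lra.
  have -> : r * (8 * L ^ 2 / r) = 8 * L ^ 2 by field; lra.
  lra.
have S0 : 0 < S by lra.
have nL : 0 < n' * L by nra.
have [half|half] := Rle_or_lt S (n' / 2).
  apply: (@Rle_trans _ (exp (S * (- 2 * L)))); last by have := exp_pos ((n' - S) * (- 2 * L)); lra.
  apply: exp_mono; rewrite pE.
  suff : 2 * L * S <= S * (S - 1) / 2 * (n' - S) * (r / (n' * L)) by lra.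
  apply: (@Rle_trans _ (S * (S - 1) / 2 * (n' / 2) * (r / (n' * L)))).
    have -> : S * (S - 1) / 2 * (n' / 2) * (r / (n' * L)) =
      S * (r * (S - 1)) / (4 * L) by field; lra.
    apply: (Rmult_le_reg_r (4 * L)); first lra.
    have -> : S * (r * (S - 1)) / (4 * L) * (4 * L) = S * (r * (S - 1)) by field; lra.
    have -> : 2 * L * S * (4 * L) = S * (8 * L ^ 2) by ring.
    by apply: Rmult_le_compat_l; lra.
  apply: Rmult_le_compat_r; first by apply/Rlt_le/Rdiv_lt_0_compat.
  by apply: Rmult_le_compat_l; [nra | lra].
apply: (@Rle_trans _ (exp ((n' - S) * (- 2 * L)))); last by have := exp_pos (S * (- 2 * L)); lra.
apply: exp_mono; rewrite pE.
suff : 2 * L * (n' - S) <= S * (S - 1) / 2 * (n' - S) * (r / (n' * L)) by lra.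
have -> : S * (S - 1) / 2 * (n' - S) * (r / (n' * L)) =
  S * (r * (S - 1)) / (2 * (n' * L)) * (n' - S) by field; lra.
apply: Rmult_le_compat_r; first lra.
apply: (Rmult_le_reg_r (2 * (n' * L))); first lra.
have -> : S * (r * (S - 1)) / (2 * (n' * L)) * (2 * (n' * L)) = S * (r * (S - 1)) by field; lra.
have -> : 2 * L * (2 * (n' * L)) = n' / 2 * (8 * L ^ 2) by field.
by apply: Rmult_le_compat; nra.
Qed.

Lemma one_sub_pow_le x T X : 0 <= x <= 1 -> 0 < X -> X <= INR T * x -> (1 - x) ^ T <= / X.
Proof.
move=> x01 X0 XT; apply: (@Rle_trans _ (exp (- X))).
  apply: (@Rle_trans _ (exp (- x) ^ T)).
    by apply: pow_incr; split; [lra | exact: one_sub_le_exp].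
  by rewrite pow_exp; apply: exp_mono; lra.
apply: Rle_trans (exp_neg_le (Rlt_le _ _ X0)) _.
by apply: Rinv_le_contravar; lra.
Qed.

Lemma exp_sub1_le x : 0 <= x <= / 2 -> exp x - 1 <= 2 * x.
Proof.
move=> x01; have h : exp x <= / (1 - x).
  rewrite -[exp x]Rinv_inv -exp_Ropp; apply: Rinv_le_contravar; first lra.
  exact: one_sub_le_exp.
have : / (1 - x) <= 1 + 2 * x.
  by apply: (Rmult_le_reg_r (1 - x)); [lra | rewrite Rinv_l; nra].
lra.
Qed.

Lemma exp_ge_cube x : 0 <= x -> (x / 3) ^ 3 <= exp x.
Proof.
move=> x0; have -> : exp x = exp (x / 3) ^ 3.
  by rewrite pow_exp; congr exp; rewrite /=; field.
by apply: pow_incr; have := exp_ineq1_le (x / 3); lra.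
Qed.

(** Numerator and denominator are each within [eta] of 1, so the quotient is within 2 eta = 1 /
    M. *)
Lemma tilted_mean (N n M : nat) (q l eta : R) :
  0 <= q <= 1 -> 0 < l -> 0 < INR M -> eta = / (2 * INR M) -> eta <= / 2 ->
  INR n * q <= l -> INR N * q <= INR n * q -> (1 - eta) * l <= INR N * q ->
  Rabs (q * (/ l - 1)) <= eta ->
  0 < 1 + q * (/ l - 1) /\
  Rabs (INR N * (q * / l / (1 + q * (/ l - 1))) - 1) <= / INR M.
Proof.
move=> q01 l0 M0 etaE eta2 up Nn low hB.
have e0 : 0 < eta by rewrite etaE; apply: Rinv_0_lt_compat; lra.
have -> : / INR M = 2 * eta by rewrite etaE; field; lra.
have [B1 B2] : 1 - eta <= 1 + q * (/ l - 1) <= 1 + eta.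
  by have := Rle_abs (q * (/ l - 1)); have := Rle_abs (- (q * (/ l - 1))); rewrite Rabs_Ropp; lra.
set B := 1 + _ in B1 B2 *; have B0 : 0 < B by lra.
split => //.
have -> : INR N * (q * / l / B) = INR N * q / l / B by field; lra.
have x1 : INR N * q / l <= 1.
  by apply: (Rmult_le_reg_r l) => //; have -> : INR N * q / l * l = INR N * q by [field; lra]; lra.
have x2 : 1 - eta <= INR N * q / l.
  by apply: (Rmult_le_reg_r l) => //; have -> : INR N * q / l * l = INR N * q by [field; lra].
set x := INR N * q / l in x1 x2 *.
apply: Rabs_le; split.
  suff : 1 - 2 * eta <= x / B by lra.
  apply: (Rmult_le_reg_r B) => //; have -> : x / B * B = x by [field; lra].
  by nra.
suff : x / B <= 1 + 2 * eta by lra.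
apply: (Rmult_le_reg_r B) => //; have -> : x / B * B = x by [field; lra].
by nra.
Qed.

(** * The lower bound for admissible parameters *)

Section LowerBound.
Variables (eps r kap th eta : R) (n N K K1 T M : nat).
Hypotheses (eps01 : 0 < eps < 1) (r0 : 0 < r) (n0 : (0 < n)%N).
Local Notation L := (ln (INR n)).
Local Notation lam := (rate eps r n).
Hypotheses (L1 : 1 <= L) (rL : r <= L) (L3 : 3 <= L).
Hypotheses (kap0 : 0 < kap <= / 2) (M4 : (4 <= M)%N)
  (hth : exp (- th) <= exp (- / INR M) * (1 - 3 / (INR M - 1)))
  (etaE : eta = / (2 * INR M)) (eta_kap : eta <= kap / 4).
Hypotheses (MK : (M <= K)%N) (K1K : (K1 <= K)%N) (K1_gt0 : (0 < K1)%N)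
  (K1_ge : (eps + kap) * L / r <= INR K1) (K1_le : INR K1 <= (eps + kap) * L / r + 1)
  (hK : 8 * L ^ 2 / r + 1 <= INR K)
  (rkap : r / L <= kap)
  (hn1 : lam K <= eta / 2 * INR n) (hn2 : 2 / (1 - eps) <= eta * INR n)
  (hN : (1 - eta / 2) * INR n <= INR N) (NTK : (N + T * K + K <= n)%N).

Local Notation q := (hit (p2_of eps n) (p3_of r n)).
Local Notation La := (1 + kap / 2).

Definition start_bound : R :=
  value_cst M La * (1 - eps) ^ M *
    exp (L / r * (ent (lam K1) - ent (1 - eps)) - INR K1 * (th + r / L / (1 - eps))).

Lemma prob_connected_survival_ge X : 0 < X -> X <= INR T * start_bound ->
  1 - / X - 4 / L <= hg_prob (p2_of eps n) (p3_of r n) (fun H => @prop_connected n H).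
Proof.
move=> X0 XT.
have L0 : 0 < L by lra.
have n_pos : 0 < INR n by apply: lt_0_INR; lia.
have M0 : 4 <= INR M by have := le_INR 4 M; rewrite /=; move=> h; apply: Rle_trans (h _); [lra|lia].
have eta0 : 0 < eta by rewrite etaE; apply: Rinv_0_lt_compat; lra.
have p2_01 : 0 <= p2_of eps n <= 1 by apply: p2_of01.
have p3_01 : 0 <= p3_of r n <= 1 by apply: p3_of01.
have q01 j : 0 <= q j <= 1 by apply: hit01.
have lam_gt j : 1 - eps <= lam j by apply: rate_ge.
have lamK1_ge : 1 + kap <= lam K1.
  rewrite /rate; suff : eps + kap <= r * INR K1 / L by lra.
  apply: (Rmult_le_reg_r L) => //; have -> : r * INR K1 / L * L = r * INR K1 by field; lra.
  have -> : (eps + kap) * L = r * ((eps + kap) * L / r) by field; lra.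
  by apply: Rmult_le_compat_l; lra.
have lamK1_le : lam K1 <= 1 + 2 * kap.
  rewrite /rate; suff : r * INR K1 / L <= eps + kap + r / L by lra.
  apply: (Rmult_le_reg_r L) => //; have -> : r * INR K1 / L * L = r * INR K1 by field; lra.
  have -> : (eps + kap + r / L) * L = r * ((eps + kap) * L / r + 1) by field; lra.
  by apply: Rmult_le_compat_l; lra.
have q_up j : INR n * q j <= lam j.
  by rewrite -mean_rate //; apply: Rmult_le_compat_l; [lra | apply: hit_le].
have NqL j : INR N * q j <= INR n * q j.
  by apply: Rmult_le_compat_r; [apply: (proj1 (q01 j)) | apply: le_INR; lia].
(* Half of [eta] pays for examining [N] candidates instead of n, half for the concavity of [hit]. *)
have q_low j : (j <= K)%N -> (1 - eta) * lam j <= INR N * q j.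
  move=> jK; have lj : lam j <= lam K by apply: rate_mono.
  have lj0 := lam_gt j.
  have := hit_ge p2_01 p3_01 j.
  set u := p2_of eps n + _; have uE : INR n * u = lam j by apply: mean_rate.
  have u0 : 0 < u.
    by apply: (Rmult_lt_reg_l (INR n)) => //; rewrite uE; lra.
  have u1 : u <= eta / 2.
    apply: (Rmult_le_reg_l (INR n)) => //; rewrite uE; lra.
  move=> hq; apply: (@Rle_trans _ ((1 - eta / 2) * INR n * (u / (1 + u)))); last first.
    apply: Rmult_le_compat => //; first by nra.
    by apply/Rlt_le/Rdiv_lt_0_compat; lra.
  have -> : (1 - eta / 2) * INR n * (u / (1 + u)) = (1 - eta / 2) / (1 + u) * lam j.
    by rewrite -uE; field; lra.
  apply: Rmult_le_compat_r; first lra.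
  apply: (Rmult_le_reg_r (1 + u)); first lra.
  have -> : (1 - eta / 2) / (1 + u) * (1 + u) = 1 - eta / 2 by field; lra.
  by nra.
have La1 : 1 < La by lra.
have crit j : (j < K1)%N ->
  0 < 1 + q j * (/ lam j - 1) /\
  Rabs (INR N * (q j * / lam j / (1 + q j * (/ lam j - 1))) - 1) <= / INR M.
  move=> jK1; have lj : lam j <= lam K1 by apply: rate_mono => //; apply: ltnW.
  have lj0 := lam_gt j; have lj1 := q_up j; have q0 := proj1 (q01 j).
  apply: (@tilted_mean N n M (q j) (lam j) eta) => //; try lra.
    by apply: q_low; apply: leq_trans (ltnW jK1) K1K.
  rewrite Rabs_mult Rabs_pos_eq //.
  have z : Rabs (/ lam j - 1) <= / (1 - eps).
    have h1 : / lam j <= / (1 - eps) by apply: Rinv_le_contravar; lra.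
    have h2 : 0 < / lam j by apply: Rinv_0_lt_compat; lra.
    have h3 : 1 <= / (1 - eps) by rewrite -[X in X <= _]Rinv_1; apply: Rinv_le_contravar; lra.
    by apply: Rabs_le; lra.
  have i0 : 0 < / (1 - eps) by apply: Rinv_0_lt_compat; lra.
  apply: (@Rle_trans _ (q j * / (1 - eps))); first exact: Rmult_le_compat_l.
  apply: (Rmult_le_reg_l (INR n)) => //.
  apply: (@Rle_trans _ (2 * / (1 - eps))); last by have := hn2; rewrite /Rdiv; lra.
  by rewrite -Rmult_assoc; apply: Rmult_le_compat_r; lra.
have super j : (K1 <= j < K)%N -> La <= INR N * q j.
  case/andP=> K1j jK; have h := q_low j (ltnW jK).
  have lj : lam K1 <= lam j by apply: rate_mono.
  apply: Rle_trans h; apply: (@Rle_trans _ ((1 - kap / 4) * (1 + kap))); first by nra.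
  by apply: Rmult_le_compat; lra.
have lam12 : 1 <= lam K1 <= 2 by lra.
pose v := value eps r n K1 M th La.
have v_start : start_bound <= v 0%N 1%N by apply: (value_start (K := K)).
have T0 := pos_INR T.
have v01 : v 0%N 1%N <= 1 -> (1 - v 0%N 1%N) ^ T <= / X.
  move=> v1; apply: one_sub_pow_le => //; first by split; [apply: value_ge0 | ].
  by apply: Rle_trans XT _; apply: Rmult_le_compat_l.
have h1 j a : j = K \/ (K <= a)%N -> v j a <= 1 by apply: value_le1.
have h2 j : v j 0%N <= 0 by apply: value_at0.
have h3 j a : (j < K)%N -> (a.+1 < K)%N ->
    v j a.+1 <= binomE (q j) N (fun i => v j.+1 (a + i)%N) 0 by apply: value_step.
have N_gt0 : (0 < N)%N.
  rewrite lt0n; apply/eqP => NE; move: hN; rewrite NE /=.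
  have : 0 < (1 - eta / 2) * INR n by apply: Rmult_lt_0_compat; lra.
  lra.
have K_gt0 : (0 < K)%N by apply: leq_trans MK; apply: leq_trans M4.
have v1 : v 0%N 1%N <= 1.
  have T_gt0 : (0 < T)%N.
    by rewrite lt0n; apply/eqP => TE; move: XT; rewrite TE /= Rmult_0_l; lra.
  apply: (explore_value_le1 (n := n) p2_01 p3_01 (N := N) (cap := K)) h3 => //.
  apply: leq_trans NTK; rewrite leq_add2r leq_add2l; exact: leq_pmull.
have y0 : 0 <= exp (- 2 * L) by exact/Rlt_le/exp_pos.
have hy := crossing_bound r0 n0 L1 rL hK.
apply: Rle_trans (prob_connected_ge p2_01 p3_01 N_gt0 K_gt0 NTK h1 h2 h3 y0 hy).
(* Since n exp (-2 L) = 1 / n, the left side is at most 2 (exp (1 / n) - 1). *)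
have : 2 * ((1 + exp (- 2 * L)) ^ n - 1) <= 4 / L.
  have e1 : (1 + exp (- 2 * L)) ^ n <= exp (exp (- L)).
    apply: (@Rle_trans _ (exp (exp (- 2 * L)) ^ n)).
      by apply: pow_incr; split; [lra | exact: exp_ineq1_le].
    rewrite pow_exp -{1}(exp_lnn n0) -exp_plus; right; congr exp; congr exp; ring.
  have e2 : exp (- L) <= / (1 + L) by apply: exp_neg_le; lra.
  have e3 : / (1 + L) <= / 4 by apply: Rinv_le_contravar; lra.
  have e4 : / (1 + L) <= / L by apply: Rinv_le_contravar; lra.
  have := @exp_sub1_le (exp (- L)); have := exp_pos (- L) => p e5.
  have := e5 ltac:(lra); rewrite /Rdiv; lra.
by have := v01 v1; lra.
Qed.

End LowerBound.

Lemma nat_ceil x : 0 <= x -> exists K : nat, x <= INR K <= x + 1.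
Proof. by move=> /nat_floor[K h]; exists K.+1; rewrite S_INR; lra. Qed.

Lemma step_loss th m : 0 < th -> 4 * (1 + th) / th + 1 <= m ->
  exp (- th) <= exp (- / m) * (1 - 3 / (m - 1)).
Proof.
move=> th0 hm.
have x0 : 4 < 4 * (1 + th) / th.
  apply: (Rmult_lt_reg_r th) => //.
  by have -> : 4 * (1 + th) / th * th = 4 * (1 + th) by [field; lra]; lra.
have a0 : 0 < / (m - 1) by apply: Rinv_0_lt_compat; lra.
have a1 : / (m - 1) <= th / (4 * (1 + th)).
  have -> : th / (4 * (1 + th)) = / (4 * (1 + th) / th) by field; lra.
  by apply: Rinv_le_contravar; lra.
have a2 : / (m - 1) <= / 3 by apply: Rinv_le_contravar; lra.
have m1 : / m <= / (m - 1) by apply: Rinv_le_contravar; lra.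
have e1 := one_sub_le_exp (/ m).
apply: Rle_trans (exp_neg_le (Rlt_le _ _ th0)) _.
apply: (@Rle_trans _ ((1 - / (m - 1)) * (1 - 3 / (m - 1)))); last first.
  by apply: Rmult_le_compat_r; rewrite /Rdiv; lra.
have -> : / (1 + th) = 1 - 4 * (th / (4 * (1 + th))) by field; lra.
rewrite /Rdiv -/(Rdiv th _); set a := / (m - 1) in a0 a1 *; nra.
Qed.

(** Budget of exponents: a trial succeeds with probability at least c n^(I - gam/4), where
    overshooting criticality costs gam/16 and the per-step losses gam/8. With about n^(1 - gam/4)
    trials the expected number of successes is of order at least n^(gam/2), while only o(n) vertices
    are burnt. *)
Lemma prob_connected_to1 eps r : 0 < eps < 1 -> 0 < r -> I_er eps r > -1 ->
  forall d, 0 < d -> exists B, forall n, (0 < n)%N -> B <= ln (INR n) ->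
  1 - d <= hg_prob (p2_of eps n) (p3_of r n) (fun H => @prop_connected n H).
Proof.
move=> eps01 r0 I1 d d0; set I := I_er eps r in I1.
pose gam := Rmin 1 (1 + I).
have [g0 g1 gI] : [/\ 0 < gam, gam <= 1 & gam <= 1 + I].
  by split; [apply: Rmin_glb_lt; lra | exact: Rmin_l | exact: Rmin_r].
pose kap := Rmin (/ 2) (gam * r / 16).
have gr : 0 < gam * r by apply: Rmult_lt_0_compat.
have [k0 k1 kg] : [/\ 0 < kap, kap <= / 2 & kap <= gam * r / 16].
  by split; [apply: Rmin_glb_lt; lra | exact: Rmin_l | exact: Rmin_r].
have ir : 0 < / r by apply: Rinv_0_lt_compat.
pose th := gam / (8 * (4 / r + 2)).
have th0 : 0 < th by apply: Rdiv_lt_0_compat; rewrite /Rdiv; lra.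
have th_def : (4 / r + 2) * th = gam / 8 by rewrite /th; field; rewrite /Rdiv; lra.
have k2 : 0 < 2 / kap by apply: Rdiv_lt_0_compat; lra.
have t2 : 0 < 4 * (1 + th) / th by apply: Rdiv_lt_0_compat; lra.
have [M [M1 _]] := @nat_ceil (4 + 2 / kap + (4 * (1 + th) / th + 1)) ltac:(lra).
have M4 : (4 <= M)%N by apply/leP/INR_le; rewrite /=; lra.
have hth : exp (- th) <= exp (- / INR M) * (1 - 3 / (INR M - 1)) by apply: step_loss => //; lra.
pose eta := / (2 * INR M).
have eta0 : 0 < eta by apply: Rinv_0_lt_compat; lra.
have eta_kap : eta <= kap / 4.
  have -> : kap / 4 = / (2 * (2 / kap)) by field; lra.
  by apply: Rinv_le_contravar; lra.
pose La := 1 + kap / 2.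
pose c := value_cst M La * (1 - eps) ^ M.
have c0 : 0 < c.
  apply: Rmult_lt_0_compat; last by apply: pow_lt; lra.
  apply: Rdiv_lt_0_compat.
    suff : / La < / 1 by rewrite Rinv_1; lra.
    by apply: Rinv_lt_contravar; rewrite /La; lra.
  by apply: Rmult_lt_0_compat; apply: pow_lt; lra.
have [e1 e2 e3] : [/\ 0 < 1 - eps, 0 < (1 - eps) * th & 0 < (1 - eps) * eta].
  by split; [lra | apply: Rmult_lt_0_compat; lra | apply: Rmult_lt_0_compat; lra].
have ge0 : 0 < gam ^ 3 * eta by apply: Rmult_lt_0_compat => //; apply: pow_lt.
have cgd : 0 < c * gam * d by apply: Rmult_lt_0_compat => //; apply: Rmult_lt_0_compat.
(* In order, these make L large enough for [rkap], [rth], [MLr], [hn1], [hn2], [TK], [iX] and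
   [iL]. *)
pose b1 := r / kap; pose b2 := r / ((1 - eps) * th); pose b3 := INR M * r.
pose b4 := 8 * (9 + 2 * r) / eta; pose b5 := 2 / ((1 - eps) * eta).
pose b6 := 4 * (8 / r + 2) * 1728 / (gam ^ 3 * eta).
pose b7 := 8 / (c * gam * d); pose b8 := 8 / d.
have p1 : 0 < b1 by apply: Rdiv_lt_0_compat.
have p2 : 0 < b2 by apply: Rdiv_lt_0_compat.
have p3 : 0 < b3 by apply: Rmult_lt_0_compat; lra.
have p4 : 0 < b4 by apply: Rdiv_lt_0_compat; lra.
have p5 : 0 < b5 by apply: Rdiv_lt_0_compat; lra.
have p6 : 0 < b6 by apply: Rdiv_lt_0_compat; rewrite /Rdiv; lra.
have p7 : 0 < b7 by apply: Rdiv_lt_0_compat; lra.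
have p8 : 0 < b8 by apply: Rdiv_lt_0_compat; lra.
exists (3 + r + b1 + b2 + b3 + b4 + b5 + b6 + b7 + b8) => n n0.
set L := ln (INR n) => BL.
have scale x y : 0 < y -> x / y <= L -> x <= L * y.
  move=> y0 h; have -> : x = x / y * y by field; lra.
  by apply: Rmult_le_compat_r; lra.
have s1 : r <= L * kap by apply: scale; rewrite -/b1; lra.
have s2 : r <= L * ((1 - eps) * th) by apply: scale; rewrite -/b2; lra.
have s4 : 8 * (9 + 2 * r) <= L * eta by apply: scale; rewrite -/b4; lra.
have s5 : 2 <= L * ((1 - eps) * eta) by apply: scale; rewrite -/b5; lra.
have s6 : 4 * (8 / r + 2) * 1728 <= L * (gam ^ 3 * eta) by apply: scale; rewrite -/b6; lra.
have s7 : 8 <= L * (c * gam * d) by apply: scale; rewrite -/b7; lra.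
have s8 : 8 <= L * d by apply: scale; rewrite -/b8; lra.
have [L3 rL L0 ML] : [/\ 3 <= L, r <= L, 0 < L & INR M * r <= L].
  by rewrite -/b3; split; lra.
clear BL scale.
have En : exp L = INR n by apply: exp_lnn.
have nL : L <= INR n by rewrite -En; have := exp_ineq1_le L; lra.
have nLL : (L / 2) ^ 2 <= INR n by rewrite -En; apply: exp_ge_sq; lra.
have LLr : 0 < 8 * L ^ 2 / r by apply: Rdiv_lt_0_compat => //; have := pow_lt L 2 L0; lra.
have Lr : 0 < L / r by apply: Rdiv_lt_0_compat.
have LLr' : 8 * (L / r) <= 8 * L ^ 2 / r.
  have -> : 8 * L ^ 2 / r = 8 * L * (L / r) by field; lra.
  by apply: Rmult_le_compat_r; lra.
have L2 : 9 <= L ^ 2 by have := pow_incr 3 L 2 ltac:(lra); lra.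
have Lg : 0 < L * gam by apply: Rmult_lt_0_compat.
have [K [K_ge K_le]] := @nat_ceil (8 * L ^ 2 / r + 1) ltac:(lra).
have ek : 0 <= (eps + kap) * L / r.
  have -> : (eps + kap) * L / r = (eps + kap) * (L / r) by field; lra.
  by apply: Rmult_le_pos; lra.
have [K1 [K1_ge K1_le]] := @nat_ceil _ ek.
have ek2 : (eps + kap) * L / r <= 3 / 2 * (L / r).
  have -> : (eps + kap) * L / r = (eps + kap) * (L / r) by field; lra.
  by apply: Rmult_le_compat_r; lra.
have K1_gt0 : (0 < K1)%N.
  have : 0 < (eps + kap) * L / r.
    have -> : (eps + kap) * L / r = (eps + kap) * (L / r) by field; lra.
    by apply: Rmult_lt_0_compat; lra.
  by move=> h; apply/leP/INR_lt; rewrite /=; lra.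
have K1K : (K1 <= K)%N by apply/leP/INR_le; lra.
have MLr : INR M <= L / r.
  by apply: (Rmult_le_reg_r r) => //; have -> : L / r * r = L by [field; lra].
have MK : (M <= K)%N by apply/leP/INR_le; lra.
pose x := exp (L * (1 - gam / 4)).
have x2 : 2 <= x.
  have := exp_ineq1_le (L * (1 - gam / 4)); rewrite -/x.
  have : L * (3 / 4) <= L * (1 - gam / 4) by apply: Rmult_le_compat_l; lra.
  lra.
have [T [T1 T2]] := @nat_floor x ltac:(lra).
have Kub : INR K <= (8 / r + 2) * L ^ 2.
  have -> : (8 / r + 2) * L ^ 2 = 8 * L ^ 2 / r + 2 * L ^ 2 by field; lra.
  by lra.
have K0 := pos_INR K; have T0 := pos_INR T.
(* Here n / x = exp (L gam / 4) is at least (L gam / 12)^3, and 1728 = 12^3. *)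
have Ltail : L ^ 2 * x <= 1728 / (gam ^ 3 * L) * INR n.
  have y3 := @exp_ge_cube (L * gam / 4) ltac:(lra).
  have nE : INR n = x * exp (L * gam / 4) by rewrite -En /x -exp_plus; congr exp; field.
  have g3 : 0 < gam ^ 3 by apply: pow_lt.
  have g3L : 0 < gam ^ 3 * L by apply: Rmult_lt_0_compat.
  have -> : L ^ 2 * x = 1728 / (gam ^ 3 * L) * (x * (L * gam / 4 / 3) ^ 3) by field; lra.
  rewrite nE; apply: Rmult_le_compat_l; first by apply/Rlt_le/Rdiv_lt_0_compat; lra.
  by apply: Rmult_le_compat_l; lra.
have TK : INR (T * K + K) <= eta / 2 * INR n.
  rewrite plus_INR mult_INR.
  apply: (@Rle_trans _ (2 * x * ((8 / r + 2) * L ^ 2))).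
    have -> : INR T * INR K + INR K = (INR T + 1) * INR K by ring.
    by apply: Rmult_le_compat; lra.
  have -> : 2 * x * ((8 / r + 2) * L ^ 2) = 2 * (8 / r + 2) * (L ^ 2 * x) by ring.
  have r8 : 0 < 2 * (8 / r + 2) by rewrite /Rdiv; lra.
  apply: Rle_trans (Rmult_le_compat_l _ _ _ (Rlt_le _ _ r8) Ltail) _.
  rewrite -Rmult_assoc; apply: Rmult_le_compat_r; first by lra.
  have g3 : 0 < gam ^ 3 by apply: pow_lt.
  have g3L : 0 < gam ^ 3 * L by apply: Rmult_lt_0_compat.
  apply: (Rmult_le_reg_r (2 * (gam ^ 3 * L))); first lra.
  have -> : 2 * (8 / r + 2) * (1728 / (gam ^ 3 * L)) * (2 * (gam ^ 3 * L)) =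
    4 * (8 / r + 2) * 1728 by field; lra.
  by lra.
have eta1 : eta <= / 8 by lra.
have TKn : (T * K + K <= n)%N.
  apply/leP/INR_le; apply: Rle_trans TK _; rewrite -[X in _ <= X]Rmult_1_l.
  by apply: Rmult_le_compat_r; lra.
pose N := (n - (T * K + K))%N.
have hN : (1 - eta / 2) * INR n <= INR N by rewrite /N minus_INR; [lra | lia].
have NTK : (N + T * K + K <= n)%N by rewrite /N; lia.
have rkap : r / L <= kap.
  by apply: (Rmult_le_reg_r L) => //; have -> : r / L * L = r by [field; lra]; lra.
have rth : r / L / (1 - eps) <= th.
  apply: (Rmult_le_reg_r (L * (1 - eps))); first by apply: Rmult_lt_0_compat.
  by have -> : r / L / (1 - eps) * (L * (1 - eps)) = r by [field; lra]; lra.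
have hn1 : rate eps r n K <= eta / 2 * INR n.
  have h : r * INR K / L <= 8 * L + 2 * r.
    apply: (Rmult_le_reg_r L) => //; have -> : r * INR K / L * L = r * INR K by field; lra.
    have : r * INR K <= r * (8 * L ^ 2 / r + 1 + 1) by apply: Rmult_le_compat_l; lra.
    have -> : r * (8 * L ^ 2 / r + 1 + 1) = 8 * L ^ 2 + 2 * r by field; lra.
    have : 2 * r * 1 <= 2 * r * L by apply: Rmult_le_compat_l; lra.
    lra.
  have h2 : eta / 2 * (L / 2) ^ 2 <= eta / 2 * INR n by apply: Rmult_le_compat_l; lra.
  have h3 : L * (8 * (9 + 2 * r)) <= L * (L * eta) by apply: Rmult_le_compat_l; lra.
  have h4 : 2 * r * 1 <= 2 * r * L by apply: Rmult_le_compat_l; lra.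
  rewrite /rate -/L; lra.
have hn2 : 2 / (1 - eps) <= eta * INR n.
  apply: (Rmult_le_reg_r (1 - eps)) => //.
  have -> : 2 / (1 - eps) * (1 - eps) = 2 by field; lra.
  have : eta * (1 - eps) * L <= eta * (1 - eps) * INR n.
    by apply: Rmult_le_compat_l => //; apply: Rmult_le_pos; lra.
  lra.
pose X := c / 2 * (L * gam / 2).
have X0 : 0 < X by apply: Rmult_lt_0_compat; lra.
have start : c * exp (L * (I - gam / 4)) <= start_bound eps r kap th n K1 M.
  apply: Rmult_le_compat_l; first lra.
  apply: exp_mono; rewrite -/L.
  set l := rate eps r n K1.
  have lE : l = 1 - eps + r * INR K1 / L by [].
  have l1 : 1 <= l.
    rewrite lE; suff : eps <= r * INR K1 / L by lra.
    apply: (Rmult_le_reg_r L) => //; have -> : r * INR K1 / L * L = r * INR K1 by field; lra.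
    apply: (@Rle_trans _ (r * ((eps + kap) * L / r))); last by apply: Rmult_le_compat_l; lra.
    have -> : r * ((eps + kap) * L / r) = (eps + kap) * L by field; lra.
    by apply: Rmult_le_compat_r; lra.
  have l2 : l <= 1 + 2 * kap.
    rewrite lE; suff : r * INR K1 / L <= eps + 2 * kap by lra.
    apply: (Rmult_le_reg_r L) => //; have -> : r * INR K1 / L * L = r * INR K1 by field; lra.
    apply: (@Rle_trans _ (r * ((eps + kap) * L / r + 1))); first by apply: Rmult_le_compat_l; lra.
    have -> : r * ((eps + kap) * L / r + 1) = (eps + kap) * L + r by field; lra.
    by lra.
  (* The derivative of [ent] vanishes at 1, so the overshoot costs at most 2 kap^2, which is at most
     kap. *)
  have h1 : - (gam * r / 16) <= ent l - ent 1.
    have := @ent_ge 1 l Rlt_0_1 ltac:(lra); rewrite ln_1.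
    have : (l - 1) ^ 2 <= (2 * kap) ^ 2 by apply: pow_incr; lra.
    have : kap * kap <= kap * / 2 by apply: Rmult_le_compat_l; lra.
    lra.
  have IE : L / r * (ent l - ent (1 - eps)) = L * I + L / r * (ent l - ent 1).
    by rewrite /I I_er_ent; [field; lra | lra | lra].
  have h2 : - (L * gam / 16) <= L / r * (ent l - ent 1).
    have -> : - (L * gam / 16) = L / r * (- (gam * r / 16)) by field; lra.
    by apply: Rmult_le_compat_l; lra.
  have h3 : INR K1 * (th + r / L / (1 - eps)) <= L * gam / 8.
    have -> : L * gam / 8 = (2 * (L / r) + L) * (2 * th).
      have -> : (2 * (L / r) + L) * (2 * th) = L * ((4 / r + 2) * th) by field; lra.
      by rewrite th_def; field.
    apply: Rmult_le_compat; [exact: pos_INR | | lra | lra].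
    have : 0 < r / L / (1 - eps) by apply: Rdiv_lt_0_compat => //; apply: Rdiv_lt_0_compat.
    lra.
  by rewrite IE; lra.
have XT : X <= INR T * start_bound eps r kap th n K1 M.
  apply: (@Rle_trans _ (x / 2 * (c * exp (L * (I - gam / 4))))); last first.
    apply: Rmult_le_compat; [lra | | lra | exact: start].
    by apply: Rmult_le_pos; [lra | exact/Rlt_le/exp_pos].
  have -> : x / 2 * (c * exp (L * (I - gam / 4))) = c / 2 * (x * exp (L * (I - gam / 4))) by field.
  apply: Rmult_le_compat_l; first lra.
  rewrite /x -exp_plus; apply: (@Rle_trans _ (exp (L * gam / 2))).
    by have := exp_ineq1_le (L * gam / 2); lra.
  apply: exp_mono; have : L * gam <= L * (1 + I) by apply: Rmult_le_compat_l; lra.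
  lra.
have iX : / X <= d / 2.
  have -> : d / 2 = / (2 / d) by field; lra.
  apply: Rinv_le_contravar; first by apply: Rdiv_lt_0_compat; lra.
  apply: (Rmult_le_reg_r d) => //; have -> : 2 / d * d = 2 by field; lra.
  by rewrite /X; lra.
have iL : 4 / L <= d / 2.
  by apply: (Rmult_le_reg_r L) => //; have -> : 4 / L * L = 4 by [field; lra]; lra.
have L1 : 1 <= L by lra.
have kap01 : 0 < kap <= / 2 by lra.
have := prob_connected_survival_ge eps01 r0 n0 L1 rL L3 kap01 M4 hth (erefl eta) eta_kap MK K1K
  K1_gt0 K1_ge K1_le K_ge rkap hn1 hn2 hN NTK X0 XT.
rewrite -/L; lra.
Qed.

Lemma hg_prob_compl n p2 p3 (P : pred {set {set 'I_n}}) :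
  hg_prob p2 p3 (fun H => ~~ P H) = 1 - hg_prob p2 p3 P.
Proof. by rewrite !hg_prob_Pr Pr_compl. Qed.

Lemma Un_cv_prob1 (U : nat -> R) :
  (exists B, forall n, (0 < n)%N -> B <= ln (INR n) -> U n <= 1) ->
  (forall d, 0 < d -> exists B, forall n, (0 < n)%N -> B <= ln (INR n) -> 1 - d <= U n) ->
  Un_cv U 1.
Proof.
case=> B0 h0 h d d0; have [B hB] := h (d / 2) ltac:(lra).
have [N1 h1] := ln_unbounded B0; have [N2 h2] := ln_unbounded B.
exists (N1 + N2)%N => n nN.
have [n0 L1] := h1 n ltac:(lia); have [_ L2] := h2 n ltac:(lia).
have := hB n n0 L2; have := h0 n n0 L1; rewrite /R_dist => u1 u2.
by apply: Rabs_def1; lra.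
Qed.

Unset Implicit Arguments.

Theorem theorem2 (eps r : R) :
  (0 < eps < 1) -> (0 < r) ->
  ((I_er eps r < -1) ->
     Un_cv (fun n => @hg_prob n (p2_of eps n) (p3_of r n)
                       (fun H => ~~ @prop_connected n H)) 1) /\
  ((I_er eps r > -1) ->
     Un_cv (fun n => @hg_prob n (p2_of eps n) (p3_of r n)
                       (fun H => @prop_connected n H)) 1).
Proof.
move=> eps01 r0.
(* The weights form a probability measure once ln n is at least max(1, r), which suffices for a
   limit. *)
have prob01 n : (0 < n)%N -> Rmax 1 r <= ln (INR n) ->
    forall P : pred {set {set 'I_n}}, 0 <= hg_prob (p2_of eps n) (p3_of r n) P <= 1.
  move=> n0 B P; rewrite hg_prob_Pr.
  have b1 := Rmax_l 1 r; have b2 := Rmax_r 1 r.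
  have pe0 e : 0 <= @pe n (p2_of eps n) (p3_of r n) e <= 1.
    by apply: pe01; [apply: p2_of01 | apply: p3_of01 => //; lra].
  by split; [apply: Pr_ge0 | apply: Pr_le1].
split=> hI; apply: Un_cv_prob1.
- exists (Rmax 1 r) => n n0 B; exact: (proj2 (prob01 n n0 B _)).
- move=> d d0; have [B hB] := prob_connected_to0 eps01 r0 hI d0.
  exists B => n n0 BL; rewrite hg_prob_compl.
  exact: Rplus_le_compat_l (Ropp_le_contravar _ _ (hB n n0 BL)).
- exists (Rmax 1 r) => n n0 B; exact: (proj2 (prob01 n n0 B _)).
exact: prob_connected_to1 eps01 r0 hI.
Qed.
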